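(* For all integers $n\geq m\geq 3$, $$R(\mathcal{C}^3_n,\mathcal{C}^3_m)=2n+\left\lfloor\frac{m-1}{2}\right\rfloor .$$
   Context: For $3$-uniform hypergraphs $\mathcal{G},\mathcal{H}$, the Ramsey number $R(\mathcal{G},\mathcal{H})$ is the smallest integer $N$ such that every red-blue coloring of the edges of the complete $3$-uniform hypergraph $\mathcal{K}^3_N$ on $N$ vertices contains a red copy of $\mathcal{G}$ or a blue copy of $\mathcal{H}$ (copies are sub-hypergraphs, not necessarily induced). The $3$-uniform loose cycle $\mathcal{C}^3_n$ has vertex set $\{v_1,\ldots,v_{2n}\}$ and the $n$ edges $e_i=\{v_{2i-1},v_{2i},v_{2i+1}\}$, $i=1,\ldots,n$, with subscripts taken mod $2n$. *)

(* Defs.v *)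
From mathcomp Require Import all_boot.

Set Implicit Arguments.
Unset Strict Implicit.
Unset Printing Implicit Defensive.

Record hypergraph := Hypergraph {
  vertex : finType;
  edges : {set {set vertex}}
}.

Definition uniform (k : nat) (G : hypergraph) : Prop :=
  forall e, e \in edges G -> #|e| = k.

(* Not necessarily induced. *)
Definition contains_copy (G H : hypergraph) : Prop :=
  exists f : vertex G -> vertex H,
    injective f /\ forall e, e \in edges G -> f @: e \in edges H.

Definition complete3 (N : nat) : hypergraph :=
  @Hypergraph 'I_N [set e : {set 'I_N} | #|e| == 3].

Inductive color := Red | Blue.

Definition is_red (c : color) : bool := if c is Red then true else false.

(* A colouring assigns a colour to every vertex set, but only its values on
   the edges of [complete3 N] are used. *)
Definition red_part (N : nat) (c : {set 'I_N} -> color) : hypergraph :=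
  @Hypergraph 'I_N [set e in edges (complete3 N) | is_red (c e)].

Definition blue_part (N : nat) (c : {set 'I_N} -> color) : hypergraph :=
  @Hypergraph 'I_N [set e in edges (complete3 N) | ~~ is_red (c e)].

Definition arrows (N : nat) (G H : hypergraph) : Prop :=
  forall c : {set 'I_N} -> color,
    contains_copy G (red_part c) \/ contains_copy H (blue_part c).

(* R(G, H) = N, as a relation: this includes the existence of R(G, H). *)
Definition is_ramsey_number (G H : hypergraph) (N : nat) : Prop :=
  arrows N G H /\ forall N', arrows N' G H -> N <= N'.

(* The vertex v_j is the residue of j modulo 2n, so v_(2n) is the ordinal 0.
   As i ranges over 0, ..., n-1, the edge below is
   e_(i+1) = {v_(2i+1), v_(2i+2), v_(2i+3)}. *)
Definition loose_edge (n i : nat) : {set 'I_(2 * n)} :=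
  [set v : 'I_(2 * n) | [|| v == 2 * i + 1 %[mod 2 * n],
                            v == 2 * i + 2 %[mod 2 * n]
                          | v == 2 * i + 3 %[mod 2 * n]]].

(* Meaningful for n >= 2; for n = 1 the edge degenerates to two vertices. *)
Definition loose_cycle (n : nat) : hypergraph :=
  @Hypergraph 'I_(2 * n) [set loose_edge n i | i : 'I_n].

Lemma loose_cycle_uniform (n : nat) : 1 < n -> uniform 3 (loose_cycle n).
Proof.
move=> n_gt1 _ /imsetP[i _ ->].
have n2_gt0 : 0 < 2 * n by rewrite muln_gt0 /= ltnW.
pose v j : 'I_(2 * n) := Ordinal (ltn_pmod (2 * i + j) n2_gt0).
have -> : loose_edge n i = [set v 1; v 2; v 3].
  by apply/setP=> x; rewrite !inE -!val_eqE /= !(modn_small (ltn_ord x)) orbA.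
have n2_gt3 : 3 < 2 * n by rewrite (@leq_mul 2 2 2 n).
have vN j k : j < 4 -> 0 < k < 4 -> j + k < 4 -> v j != v (j + k).
  move=> _ /andP[k_gt0 k_lt4] _.
  rewrite -val_eqE /= addnA -[X in X == _ %[mod _]]addn0 eqn_modDl mod0n.
  by rewrite modn_small ?(leq_trans k_lt4) // eq_sym -lt0n.
rewrite setUC cardsU1 cards2 !inE ![v 3 == _]eq_sym.
by rewrite (negbTE (vN 1 2 _ _ _)) // (negbTE (vN 2 1 _ _ _)) // (vN 1 1).
Qed.

(* Main.v *)
Require Import Defs.
From mathcomp Require Import all_boot zify.

(** Lower bound: colour red the triples inside a fixed set of [2 * n - 1]
    vertices. A red cycle would need [2 * n] vertices there, and a blue one more
    than [(m - 1) %/ 2] vertices outside, since a vertex lies on at most two edges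
    of a loose cycle.

    Upper bound: by induction, and after exchanging the colours if [n = m], there
    is a red cycle with [n - 1] edges; let [W] be the set of the remaining
    vertices, and assume that no red cycle has [n] edges. Then [L] consecutive red
    edges cannot be replaced by a red path with [L + 1] edges that uses only their
    own vertices and [W]. Two consecutive red edges therefore yield a blue path
    with two edges between any two vertices of [W], with one possible exception in
    [W]; this blue path misses the last vertex of the two red edges, or else the
    next two or three red edges can be included to the same effect. Joining such
    paths along the red cycle, and trading the last two (for odd [m]) or three (for
    even [m]) red edges for a blue path with one edge more, closes a blue cycle
    with [m] edges; that last trade may need a shift by one edge along the cycle. The local statements concern at most 16 vertices and are
    refutations of small sets of clauses in the colours of the triples. *)

Set Implicit Arguments.
Unset Strict Implicit.
Unset Printing Implicit Defensive.

(** * Refutation by unit propagation and branching *)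

Section Certificates.

Definition triple := (nat * nat * nat)%type.

Definition triple_eqb (a b : triple) :=
  [&& eqn a.1.1 b.1.1, eqn a.1.2 b.1.2 & eqn a.2 b.2].

(** A sorted triple of indices stands for an unordered triple of vertices, so that each edge has a
    single propositional variable. *)
Definition sort3 (i j k : nat) : triple :=
  if i <= j then
    if j <= k then (i, j, k) else if i <= k then (i, k, j) else (k, i, j)
  else
    if i <= k then (j, i, k) else if j <= k then (j, k, i) else (k, j, i).

(** The pair [(b, t)] says that the triple [t] has the colour [b], where [true] is red. *)
Definition literal := (bool * triple)%type.

Definition lit_eqb (a b : literal) := eqb a.1 b.1 && triple_eqb a.2 b.2.

Definition negl (l : literal) : literal := (~~ l.1, l.2).

Definition assign (l : literal) (cs : seq (seq literal)) :=
  [seq [seq l' <- c | ~~ lit_eqb (negl l) l'] | c <- cs & ~~ has (lit_eqb l) c].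

Fixpoint find_unit (cs : seq (seq literal)) : option literal :=
  match cs with
  | [:: l] :: _ => Some l
  | _ :: cs' => find_unit cs'
  | [::] => None
  end.

(* DPLL where the branching variables are read off a list; [Some ds] means that
   [cs] is refuted and [ds] is the part of the list that was not consumed. *)
Fixpoint refute (fuel : nat) (cs : seq (seq literal)) (ds : seq triple) :
    option (seq triple) :=
  if fuel is fuel'.+1 then
    if has (@nilp _) cs then Some ds else
    if find_unit cs is Some l then refute fuel' (assign l cs) ds else
    if ds is t :: ds1 then
      if refute fuel' (assign (true, t) cs) ds1 is Some ds2 then
        refute fuel' (assign (false, t) cs) ds2
      else None
    else None
  else None.

Definition satisfies (rho : triple -> bool) (c : seq literal) :=
  has (fun l => rho l.2 == l.1) c.

Lemma triple_eqbP a b : reflect (a = b) (triple_eqb a b).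
Proof.
case: a => [[a1 a2] a3]; case: b => [[b1 b2] b3]; rewrite /triple_eqb /= !eqnE.
by apply: (iffP and3P) => [[/eqP-> /eqP-> /eqP->]|[-> -> ->]].
Qed.

Lemma lit_eqbP a b : reflect (a = b) (lit_eqb a b).
Proof.
case: a => [a1 a2]; case: b => [b1 b2]; apply: (iffP andP) => /=.
  by case=> /eqP-> /triple_eqbP->.
by case=> -> ->; split; [apply/eqP|apply/triple_eqbP].
Qed.

Lemma assign_satisfies rho l cs :
  rho l.2 == l.1 -> all (satisfies rho) cs -> all (satisfies rho) (assign l cs).
Proof.
move=> rl /allP sat; apply/allP => c' /mapP[c]; rewrite mem_filter => /andP[_ cin ->].
have /hasP[l' l'c rl'] := sat c cin.
apply/hasP; exists l' => //; rewrite mem_filter l'c andbT.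
apply: contraTN rl' => /lit_eqbP <- /=.
by rewrite (eqP rl); case: l.1.
Qed.

Lemma find_unit_mem cs l : find_unit cs = Some l -> [:: l] \in cs.
Proof.
elim: cs => [//|[|l1 [|l2 c]] cs IH] /=; rewrite inE.
- by move/IH->; rewrite orbT.
- by case=> ->; rewrite eqxx.
- by move/IH->; rewrite orbT.
Qed.

(** The list [ds] and the fuel only steer the search. Every step is a forced assignment or a case
    distinction on one triple, so success proves unsatisfiability whatever they are. *)
Lemma refute_sound rho fuel cs ds :
  refute fuel cs ds -> ~~ all (satisfies rho) cs.
Proof.
elim: fuel cs ds => [//|f IH] cs ds /=.
case: ifP => [/hasP[c cin /nilP c0] _|_].
  by apply/allPn; exists c => //; rewrite c0.
case E: (find_unit cs) => [l|].
  move/IH; apply: contra => sat; apply: assign_satisfies => //.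
  by have := allP sat _ (find_unit_mem E); rewrite /satisfies /= orbF.
case: ds => [//|t ds1].
case E1: (refute _ _ ds1) => [ds2|//] E2.
have {}E1 : refute f (assign (true, t) cs) ds1 by rewrite E1.
apply/negP => sat; case rt: (rho t).
  by move/negP: (IH _ _ E1); apply; apply: assign_satisfies => //=; rewrite rt.
by move/negP: (IH _ _ E2); apply; apply: assign_satisfies => //=; rewrite rt.
Qed.

Fixpoint edges_of (i : nat) (p : seq nat) : seq triple :=
  if p is j :: k :: p' then sort3 i j k :: edges_of k p' else [::].

(* Colour, length, first vertex, last vertex, admissible further vertices. *)
Definition goal := (bool * nat * nat * nat * seq nat)%type.
Definition gcol (g : goal) := g.1.1.1.1.
Definition glen (g : goal) := g.1.1.1.2.
Definition gsrc (g : goal) := g.1.1.2.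
Definition gtgt (g : goal) := g.1.2.
Definition gvia (g : goal) := g.2.

(* A coloured path, given by the indices of its vertices. *)
Definition pattern := (bool * seq nat)%type.
Definition psrc (pt : pattern) := head 0 pt.2.
Definition ptail (pt : pattern) := behead pt.2.

Definition fits (pt : pattern) (g : goal) :=
  [&& eqb pt.1 (gcol g), eqn (psrc pt) (gsrc g), eqn (size (ptail pt)) (2 * glen g),
      eqn (last (psrc pt) (ptail pt)) (gtgt g) &
      all (fun i => has (eqn i) (gtgt g :: gvia g)) (ptail pt)].

Fixpoint nodup (s : seq nat) :=
  if s is i :: s' then ~~ has (eqn i) s' && nodup s' else true.

Definition pattern_ok (n e : nat) (gs : seq goal) (pt : pattern) :=
  [&& nodup (ptail pt), all (fun i => i < n) (ptail pt),
      ~~ has (eqn 0) (ptail pt) || ~~ has (eqn e) (ptail pt) & has (fits pt) gs].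

Definition clause_of (pt : pattern) : seq literal :=
  [seq (~~ pt.1, t) | t <- edges_of (psrc pt) (ptail pt)].

(* If no goal is realized, then no listed path has all its edges in its colour;
   [check] verifies that these clauses contradict [H]. *)
Definition check (n e : nat) (gs : seq goal) (H : seq (seq literal))
    (reds blues : seq (seq nat)) (ds : seq triple) :=
  let ps := [seq (true, p) | p <- reds] ++ [seq (false, p) | p <- blues] in
  all (pattern_ok n e gs) ps &&
  refute 1000 (H ++ [seq clause_of pt | pt <- ps]) ds.

End Certificates.

(** * Loose paths in a symmetric ternary relation, and the meaning of a certificate *)

Section LoosePaths.

Variable T : finType.
Implicit Types (r : T -> T -> T -> bool) (x y z : T) (s t p : seq T).

Definition symmetric3 r :=
  (forall x y z, r x y z = r y x z) /\ (forall x y z, r x y z = r x z y).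

Definition colour r (b : bool) : T -> T -> T -> bool :=
  if b then r else fun x y z => ~~ r x y z.

(* The loose path starting at [x] whose further vertices are listed by [s]. *)
Fixpoint lpath r x s : bool :=
  if s is y :: z :: s' then r x y z && lpath r z s' else true.

(* For [x = y] this is a loose cycle. *)
Definition linked r (L : nat) x y s : bool :=
  [exists p : (2 * L).-tuple T,
    [&& uniq p, last x p == y, all [in y :: s] p & lpath r x p]].

Lemma linkedP r L x y s :
  reflect (exists p, [/\ size p = 2 * L, uniq p, last x p = y,
                         {subset p <= y :: s} & lpath r x p])
          (linked r L x y s).
Proof.
apply: (iffP existsP) => [[p /and4P[up /eqP lp /allP sp pp]]|[p [sz up lp sp pp]]].
  by exists p; rewrite size_tuple.
move/eqP: sz => sz; exists (Tuple sz); rewrite /= up lp eqxx pp andbT /=.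
by apply/allP.
Qed.

Lemma linked_sub r L x y s1 s2 :
  {subset s1 <= s2} -> linked r L x y s1 -> linked r L x y s2.
Proof.
move=> sub /linkedP[p [sz up lp sp pp]]; apply/linkedP; exists p; split=> // z /sp.
by rewrite !inE => /predU1P[->|/sub->]; rewrite ?eqxx ?orbT.
Qed.

Definition valuation r x s (t : triple) :=
  r (nth x (x :: s) t.1.1) (nth x (x :: s) t.1.2) (nth x (x :: s) t.2).

Lemma valuation_sort3 r x s i j k : symmetric3 r ->
  valuation r x s (sort3 i j k) =
  r (nth x (x :: s) i) (nth x (x :: s) j) (nth x (x :: s) k).
Proof.
case=> r12 r23; rewrite /valuation.
have : sort3 i j k \in
    [:: (i, j, k); (i, k, j); (k, i, j); (j, i, k); (j, k, i); (k, j, i)].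
  by rewrite /sort3; do !case: ifP => _; rewrite !inE eqxx ?orbT.
move: (nth x (x :: s)) (sort3 i j k) => v t.
rewrite !inE => /or4P[/eqP->|/eqP->|/eqP->|/or3P[]/eqP->] //=.
- by rewrite r12 r23.
- by rewrite r23 r12.
- by rewrite r12 r23 r12.
Qed.

Lemma lpath_colour_edges r x s b i (p : seq nat) : symmetric3 r ->
  lpath (colour r b) (nth x (x :: s) i) (map (nth x (x :: s)) p) =
  all (fun t : triple => valuation r x s t == b) (edges_of i p).
Proof.
move=> r3; have [n] := ubnP (size p).
elim: n i p => [//|n IH] i [|j [|k p]] //= sz.
rewrite IH; last by rewrite !ltnS in sz; apply: leq_trans sz.
by rewrite valuation_sort3 // /colour; case: (b); rewrite ?eqb_id ?eqbF_neg.
Qed.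

Definition realized r x s (g : goal) :=
  linked (colour r (gcol g)) (glen g) (nth x (x :: s) (gsrc g))
    (nth x (x :: s) (gtgt g)) (map (nth x (x :: s)) (gvia g)).

Lemma nodupE (s : seq nat) : nodup s = uniq s.
Proof.
elim: s => //= i s ->; congr (~~ _ && _).
by rewrite -has_pred1; apply: eq_has => j; rewrite eqnE eq_sym.
Qed.

Lemma has_eqn i (s : seq nat) : has (eqn i) s = (i \in s).
Proof. by rewrite -has_pred1; apply: eq_has => j; rewrite eqnE eq_sym. Qed.

(* The vertices indexed by [0] and [e] may coincide: this happens when a path
   runs once around a loose cycle. *)
Lemma check_sound r x s e gs H reds blues ds : symmetric3 r ->
  uniq s -> uniq (take e (x :: s) ++ drop e.+1 (x :: s)) ->
  all (satisfies (valuation r x s)) H ->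
  check (size s).+1 e gs H reds blues ds -> has (realized r x s) gs.
Proof.
rewrite /check => r3 us ue Hsat.
case/andP=> /allP psok /(refute_sound (valuation r x s)).
(* A clause violated by the actual colouring must come from a listed path. All edges of that path
   then have its colour, and the path realizes a goal. *)
rewrite all_cat Hsat /= => /allPn[c /mapP[[b ip] pin ->] cF].
have := psok _ pin; rewrite /pattern_ok /clause_of /fits in cF *.
move: cF; rewrite /psrc /ptail /=; set i := head 0 ip; set p := behead ip => cF.
rewrite nodupE => /and4P[/= up szp zp].
move=> /hasP[g gin]; move=> /and5P[/eqP bE /eqP iE /eqP szE /eqP lE /allP via].
apply/hasP; exists g => //; apply/linkedP.
set v := nth x (x :: s); exists (map v p).
(* The path avoids the index [0] or the index [e]. In the first case [uniq s] separates its
   vertices, in the second the uniqueness of the list without its entry [e]. *)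
have vinj : {in p &, injective v}.
  move=> j k jp kp; have /allP ltp := szp.
  have /= ltj := ltp _ jp; have /= ltk := ltp _ kp.
  case/orP: zp; rewrite has_eqn => zp.
    have : j != 0 by apply: contraNneq zp => <-.
    have : k != 0 by apply: contraNneq zp => <-.
    case: k kp ltk => // k _ ltk _; case: j jp ltj => // j _ ltj _ /=.
    by rewrite /v /= => /eqP; rewrite nth_uniq // => /eqP->.
  have je : j != e by apply: contraNneq zp => <-.
  have ke : k != e by apply: contraNneq zp => <-.
  (* Once the entry [e] is deleted, the later indices drop by one. *)
  have nthE l : l < (size s).+1 -> l != e ->
     v l = nth x (take e (x :: s) ++ drop e.+1 (x :: s)) (if l < e then l else l.-1).
    move=> ll le; have [lte|] := ltnP l e.
      rewrite nth_cat size_take -[(size s).+1]/(size (x :: s)) in ll *.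
      by case: (ltnP e (size (x :: s))) => _; rewrite ?lte ?ll nth_take.
    rewrite leq_eqVlt eq_sym (negPf le) /= => elt.
    have lte : e < (size s).+1 by apply: leq_ltn_trans (ltnW elt) _.
    case: l elt {le} ll => // l elt ll /=.
    rewrite nth_cat size_take /= lte ltnNge -ltnS elt /= nth_drop.
    by rewrite subnKC.
  have bnd l : l < (size s).+1 -> l != e -> 
     (if l < e then l else l.-1) < size (take e (x :: s) ++ drop e.+1 (x :: s)).
    move=> ll le; rewrite size_cat size_take size_drop /=.
    move: ll le; clear; case: (ltnP l e); case: (ltnP e (size s).+1); lia.
  rewrite (nthE j) // (nthE k) // => /eqP; rewrite nth_uniq ?bnd //.
  move: je ke; clear; case: (ltnP j e); case: (ltnP k e); lia.
split.
- by rewrite size_map.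
- by rewrite map_inj_in_uniq.
- by rewrite -iE last_map lE.
- move=> z /mapP[j /via jin ->]; move: jin; rewrite /= has_eqn inE.
  by case/orP => [/eqP->|jin]; rewrite ?eqxx // map_f ?orbT.
rewrite -bE -iE lpath_colour_edges //; apply/allP => t tin.
apply: contraNT cF => tb; apply/hasP; exists (~~ b, t).
  by apply/mapP; exists t.
by move: tb => /=; case: (valuation _ _ _ _); case: (b).
Qed.

(** If [t] lies on a red cycle and [w] off it, a detour of this kind would make the cycle longer by
    one edge. The even size of [t1] lets [t2] start at the end of an edge, not in the middle of
    one. *)
Definition detour_free r x t w :=
  forall t1 t2 t3 L, t = t1 ++ t2 ++ t3 -> ~~ odd (size t1) -> 0 < L ->
    size t2 = 2 * L -> ~~ linked r L.+1 (last x t1) (last x (t1 ++ t2)) (t2 ++ w).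

Lemma detour_free_catl r x t1 t2 w :
  detour_free r x (t1 ++ t2) w -> detour_free r x t1 w.
Proof.
move=> df s1 s2 s3 L E; apply: (df s1 s2 (s3 ++ t2)).
by rewrite E -!catA.
Qed.

Lemma detour_free_catr r x t1 t2 w : ~~ odd (size t1) ->
  detour_free r x (t1 ++ t2) w -> detour_free r (last x t1) t2 w.
Proof.
move=> ev df s1 s2 s3 L E ev1 L0 sz; rewrite -!last_cat catA.
apply: (df (t1 ++ s1) s2 s3) => //.
  by rewrite E !catA.
by rewrite size_cat oddD (negPf ev).
Qed.

Lemma detour_free_sub r x t w1 w2 : {subset w1 <= w2} ->
  detour_free r x t w2 -> detour_free r x t w1.
Proof.
move=> sub df t1 t2 t3 L E ev L0 sz; apply: contra (df _ _ _ _ E ev L0 sz).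
by apply: linked_sub => z; rewrite !mem_cat => /orP[->|/sub->]; rewrite ?orbT.
Qed.

(** The red detour to be excluded for the [il.2] edges from edge [il.1] on, counted from zero. The
    indices after [2 * q] belong to the [k] vertices off the path. *)
Definition window (q k : nat) (il : nat * nat) :=
  (true, il.2.+1, 2 * il.1, 2 * (il.1 + il.2),
    iota (2 * il.1).+1 (2 * il.2) ++ iota (2 * q).+1 k) : goal.

Definition windows (q k : nat) :=
  [seq window q k il | il <- [seq (i, l) | i <- iota 0 q, l <- iota 1 (q - i)]].

Definition base_edges (q : nat) : seq (seq literal) :=
  [seq [:: (true, e)] | e <- edges_of 0 (iota 1 (2 * q))].

Definition blue (g : nat * nat * nat * seq nat) : goal :=
  (false, g.1.1.1, g.1.1.2, g.1.2, g.2).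

(** Every window is a detour that [detour_free] excludes, so the goal that the certificate yields
    has to be a blue one. *)
Lemma local_check r x t w H gs reds blues ds q W : symmetric3 r ->
  size t = 2 * q -> uniq (t ++ w) -> uniq (belast x t ++ w) ->
  {subset w <= W} -> lpath r x t -> detour_free r x t W ->
  all (satisfies (valuation r x (t ++ w))) H ->
  check (2 * q + size w).+1 (2 * q) (windows q (size w) ++ map blue gs)
    (base_edges q ++ H) reds blues ds ->
  has (fun g => realized r x (t ++ w) (blue g)) gs.
Proof.
move=> r3 sz ut ub sub pt df Hsat chk.
have /detour_free_sub/(_ df) {}df := sub.
have : has (realized r x (t ++ w)) (windows q (size w) ++ map blue gs).
  apply: (check_sound (e := 2 * q) (H := base_edges q ++ H)
    (reds := reds) (blues := blues) (ds := ds)) => //.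
  (* The index [2 * q] is that of the last vertex of [t], which equals [x] if the path makes a full
     turn. *)
  - suff -> : take (2 * q) (x :: t ++ w) ++ drop (2 * q).+1 (x :: t ++ w) =
      belast x t ++ w by [].
    rewrite -cat_cons lastI cat_rcons -sz take_size_cat ?size_belast //; congr (_ ++ _).
    by rewrite -cat_rcons -lastI drop_size_cat.
  - rewrite all_cat Hsat andbT; apply/allP => _ /mapP[t0 t0in ->].
    rewrite /satisfies /= orbF.
    have := lpath_colour_edges x (t ++ w) true 0 (iota 1 (2 * q)) r3.
    rewrite /colour /=.
    have -> : map (nth x (x :: t ++ w)) (iota 1 (2 * q)) = t.
      rewrite -[1]/(1 + 0) iotaDl -map_comp -[RHS](mkseq_nth x) sz.
      apply/eq_in_map => j; rewrite mem_iota => /= jlt.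
      by rewrite nth_cat sz jlt.
    by rewrite pt => /esym/allP/(_ _ t0in).
  - by rewrite size_cat sz.
rewrite has_cat has_map => /orP[/hasP[g /mapP[il /allpairsPdep[i' [l' [i1 l1 ->]]]]]|//].
move=> -> {g} real; move: i1 l1; rewrite !mem_iota => i1 l1.
have iq : i' < q by lia.
have l0 : 0 < l' by lia.
have {i1 l1}lq : i' + l' <= q by lia.
(* The window cuts [t] before its edge [i'] and again [l'] edges later. *)
set t1 := take (2 * i') t; set t2 := take (2 * l') (drop (2 * i') t).
have s1 : size t1 = 2 * i'.
  by rewrite size_take sz ltn_mul2l /= iq.
have s2 : size t2 = 2 * l'.
  rewrite size_takel // size_drop sz -mulnBr leq_mul2l /=.
  by rewrite leq_subRL ?(ltnW iq).
have tE : t = t1 ++ t2 ++ drop (2 * l') (drop (2 * i') t) by rewrite !cat_take_drop.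
have nthl j : j <= size t -> nth x (x :: t ++ w) j = last x (take j t).
  case: j => [|j] jt; first by rewrite take0.
  rewrite /= nth_cat jt (last_nth x) size_takel //=.
  by rewrite nth_take.
have := df _ _ _ _ tE _ l0 s2; rewrite s1 mul2n odd_double => /(_ isT)/negP[].
have {real} : linked r l'.+1 (nth x (x :: t ++ w) (2 * i'))
    (nth x (x :: t ++ w) (2 * (i' + l'))) (map (nth x (x :: t ++ w))
      (iota (2 * i').+1 (2 * l') ++ iota (2 * q).+1 (size w))) by [].
rewrite !nthl ?sz ?leq_mul2l ?(ltnW iq) // mulnDr takeD.
apply: linked_sub => z; rewrite map_cat !mem_cat => /orP[/mapP[j jin ->]|/mapP[j jin ->]].
  move: jin; rewrite mem_iota => /andP[j1 j2]; case: j j1 j2 => // j j1 j2 /=.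
  rewrite ltnS in j1; rewrite addSn !ltnS -mulnDr in j2.
  have jt : j < size t by rewrite sz; apply: leq_trans j2 _; rewrite leq_mul2l lq.
  rewrite nth_cat jt {1}tE nth_cat s1 ltnNge j1 /= nth_cat s2.
  have -> : j - 2 * i' < 2 * l' by rewrite ltn_subLR // -mulnDr.
  by rewrite mem_nth // s2 ltn_subLR // -mulnDr.
move: jin; rewrite mem_iota => /andP[j1 j2]; case: j j1 j2 => // j j1 j2 /=.
rewrite ltnS in j1; rewrite addSn ltnS in j2.
rewrite nth_cat sz ltnNge j1 /= mem_nth ?orbT //.
by rewrite ltn_subLR.
Qed.

End LoosePaths.

(** * Stretches of a red cycle *)

Section Stretches.

Variable T : finType.
Variable r : T -> T -> T -> bool.
Hypothesis r_sym : symmetric3 r.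
Implicit Types (x y z w a b c d e f : T) (s t p ws W : seq T).

Local Notation linkedB := (linked (colour r false)).

Lemma lpath_cat (r0 : T -> T -> T -> bool) x s1 s2 : ~~ odd (size s1) ->
  lpath r0 x (s1 ++ s2) = lpath r0 x s1 && lpath r0 (last x s1) s2.
Proof.
have [n] := ubnP (size s1); elim: n x s1 => // n IH x [|y [|z s1]] //= sz ev.
rewrite IH ?andbA //; last by rewrite negbK in ev.
by rewrite !ltnS in sz; apply: leq_trans sz.
Qed.

(* A stretch of a red loose cycle; [W] consists of vertices off the cycle. *)
Definition stretch x t W :=
  [/\ uniq (t ++ W), uniq (belast x t ++ W), lpath r x t & detour_free r x t W].

Lemma stretch_catl x t1 t2 W : ~~ odd (size t1) ->
  stretch x (t1 ++ t2) W -> stretch x t1 W.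
Proof.
move=> ev [u1 u2 pt df]; split.
- by apply: subseq_uniq u1; rewrite -catA; apply/cat_subseq/suffix_subseq.
- by apply: subseq_uniq u2; rewrite belast_cat -catA; apply/cat_subseq/suffix_subseq.
- by move: pt; rewrite lpath_cat // => /andP[].
- exact: detour_free_catl df.
Qed.

Lemma stretch_catr x t1 t2 W : ~~ odd (size t1) ->
  stretch x (t1 ++ t2) W -> stretch (last x t1) t2 W.
Proof.
move=> ev [u1 u2 pt df]; split.
- by apply: subseq_uniq u1; rewrite -catA suffix_subseq.
- by apply: subseq_uniq u2; rewrite belast_cat -catA suffix_subseq.
- by move: pt; rewrite lpath_cat // => /andP[].
- exact: detour_free_catr df.
Qed.

(* The vertices of [x :: t] have the indices [0], ..., [2 * q], followed by those of
   [ws]. The lists [reds], [blues] and [ds] used below come from a SAT solver. *)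
Lemma stretch_check x t W ws H gs reds blues ds q : stretch x t W ->
  uniq ws -> all [in W] ws -> size t = 2 * q ->
  all (satisfies (valuation r x (t ++ ws))) H ->
  check (2 * q + size ws).+1 (2 * q) (windows q (size ws) ++ map blue gs)
    (base_edges q ++ H) reds blues ds ->
  has (fun g => realized r x (t ++ ws) (blue g)) gs.
Proof.
move=> [u1 u2 pt df] uw /allP sub sz.
have disj s : uniq (s ++ W) -> uniq (s ++ ws).
  rewrite !cat_uniq uw andbT => /and3P[-> /= h _].
  by apply: contra h => /hasP[z /sub zW zt]; apply/hasP; exists z.
exact: local_check r_sym sz (disj _ u1) (disj _ u2) sub pt df.
Qed.

Definition regular x t w := ~~ (r x (nth x t 0) w && r (nth x t 0) (nth x t 1) w).

(** Two exceptions [f] and [w] would give the red path [x], [f], [v1], [w], [v2], a detour for the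
    first edge. *)
Lemma one_irregular x t W : 1 < size t -> stretch x t W ->
  exists f, {in W, forall w, w != f -> regular x t w}.
Proof.
case: t => [|v1 [|v2 t]] // _ [uW _ _ df]; rewrite /regular /=.
have [/allP all_reg|] := boolP (all (fun w => ~~ (r x v1 w && r v1 v2 w)) W).
  by exists x => w wW _; apply: all_reg.
case/allPn => f fW; rewrite negbK => /andP[r1 r2]; exists f => w wW wf.
apply/negP => /andP[_ r3].
have /negP[] := df [::] [:: v1; v2] t 1 erefl isT isT erefl.
have [r12 r23] := r_sym.
apply/linkedP; exists [:: f; v1; w; v2]; split => //.
- move: uW; rewrite cat_uniq => /and3P[/= /and3P[v12 _ _] /hasPn dW _].
  have := dW _ fW; have := dW _ wW; rewrite /= !inE !negb_or in v12 *.
  case/and3P=> wv1 wv2 _ /and3P[fv1 fv2 _]; case/andP: v12 => v12 _.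
  by rewrite fv1 fv2 v12 [f == w]eq_sym wf ![v1 == w]eq_sym wv1 wv2.
- by move=> z; rewrite !inE => /or4P[]/eqP->; rewrite ?fW ?wW ?eqxx ?orbT.
- by rewrite /= andbT r23 r1 /= r23.
Qed.

Local Ltac explode t := repeat (destruct t as [|? t]; try discriminate).

(** A step of the chain from label to label. If the first two red edges give no blue path from [w1]
    to [w2], then four red edges together give one of twice the length that goes on to [w3]. Either
    path avoids the last vertex of its red edges, where the next piece begins. *)
Lemma pair_pair x t w1 w2 w3 W : size t = 8 -> stretch x t W ->
  uniq [:: w1; w2; w3] -> all [in W] [:: w1; w2; w3] ->
  regular x t w1 -> regular x t w2 ->
  linkedB 2 w1 w2 (belast x (take 4 t)) || linkedB 4 w1 w3 (belast x t ++ [:: w2]).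
Proof.
move=> st str uw sub; rewrite /regular => n1 n2; explode t.
(* Index [0] is [x], those up to [8] are [t], and [9], [10], [11] are [w1], [w2], [w3]. The clauses
   in [H] say that [w1] and [w2] are regular. *)
rewrite -[X in _ || X]orbF; apply: (stretch_check str uw sub (q := 4)
    (H := [:: [:: (false, (0, 1, 9)); (false, (1, 2, 9))];
      [:: (false, (0, 1, 10)); (false, (1, 2, 10))]])
    (gs := [:: (2, 9, 10, [:: 0; 1; 2; 3]);
      (4, 9, 11, [:: 0; 1; 2; 3; 4; 5; 6; 7; 10])])
    (reds := [:: [:: 0; 2; 1; 10; 3; 9; 4]; [:: 0; 9; 3; 1; 10; 2; 4];
      [:: 0; 9; 3; 4; 2; 10; 1; 11; 6]; [:: 0; 9; 1; 10; 3; 2; 4]])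
    (blues := [:: [:: 9; 0; 1; 2; 10]; [:: 9; 0; 1; 3; 10];
      [:: 9; 3; 0; 1; 10]; [:: 9; 3; 4; 2; 10; 0; 1; 6; 11];
      [:: 9; 2; 1; 3; 10]])
    (ds := [:: (1, 3, 10)])); [by [] | | by vm_compute].
by rewrite /satisfies /valuation /= !orbF !eqbF_neg -!negb_and n1 n2.
Qed.

(** For the last pair of the chain. If it has no two-edge path of its own, it is used jointly with
    the two closing red edges for [2 + 3] blue edges, with [c] and [d] as further helpers. *)
Lemma pair_closing2 x t w1 w2 w3 c d W : size t = 8 -> stretch x t W ->
  uniq [:: w1; w2; w3; c; d] -> all [in W] [:: w1; w2; w3; c; d] ->
  regular x t w1 -> regular x t w2 ->
  linkedB 2 w1 w2 (belast x (take 4 t)) ||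
  linkedB 5 w1 w3 (belast x t ++ [:: w2; c; d]).
Proof.
move=> st str uw sub; rewrite /regular => n1 n2; explode t.
rewrite -[X in _ || X]orbF; apply: (stretch_check str uw sub (q := 4)
    (H := [:: [:: (false, (0, 1, 9)); (false, (1, 2, 9))];
      [:: (false, (0, 1, 10)); (false, (1, 2, 10))]])
    (gs := [:: (2, 9, 10, [:: 0; 1; 2; 3]);
      (5, 9, 11, [:: 0; 1; 2; 3; 4; 5; 6; 7; 10; 12; 13])])
    (reds := [:: [:: 0; 9; 2; 4; 3; 1; 10; 5; 7; 6; 8];
      [:: 0; 2; 1; 10; 3; 9; 5; 4; 6]; [:: 0; 3; 9; 1; 2; 11; 4];
      [:: 0; 2; 9; 3; 1; 12; 4]; [:: 0; 10; 1; 9; 3; 2; 4]])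
    (blues := [:: [:: 9; 3; 0; 1; 10]; [:: 9; 3; 1; 0; 10];
      [:: 9; 3; 1; 2; 10]; [:: 9; 0; 1; 3; 10]; [:: 9; 2; 0; 1; 10];
      [:: 9; 2; 1; 0; 10]; [:: 9; 3; 5; 7; 10; 0; 1; 12; 4; 2; 11]])
    (ds := [:: (0, 1, 10)])); [by [] | | by vm_compute].
by rewrite /satisfies /valuation /= !orbF !eqbF_neg -!negb_and n1 n2.
Qed.

(** Here the path returns to its start, as required when the chain has a single pair. *)
Lemma pair_closing2_cycle x t w1 w2 c d W : size t = 8 -> stretch x t W ->
  uniq [:: w1; w2; c; d] -> all [in W] [:: w1; w2; c; d] ->
  regular x t w1 -> regular x t w2 ->
  linkedB 2 w1 w2 (belast x (take 4 t)) ||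
  linkedB 5 w1 w1 (belast x t ++ [:: w2; c; d]).
Proof.
move=> st str uw sub; rewrite /regular => n1 n2; explode t.
rewrite -[X in _ || X]orbF; apply: (stretch_check str uw sub (q := 4)
    (H := [:: [:: (false, (0, 1, 9)); (false, (1, 2, 9))];
      [:: (false, (0, 1, 10)); (false, (1, 2, 10))]])
    (gs := [:: (2, 9, 10, [:: 0; 1; 2; 3]);
      (5, 9, 9, [:: 0; 1; 2; 3; 4; 5; 6; 7; 10; 11; 12])])
    (reds := [:: [:: 0; 3; 9; 1; 2; 10; 4]; [:: 0; 10; 3; 4; 2; 1; 9; 12; 6];
      [:: 0; 2; 1; 9; 3; 12; 4]; [:: 0; 3; 9; 2; 1; 10; 5; 4; 6];
      [:: 0; 10; 1; 9; 3; 2; 4]])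
    (blues := [:: [:: 9; 3; 0; 1; 10]; [:: 9; 2; 1; 0; 10];
      [:: 9; 1; 0; 3; 10]; [:: 9; 3; 1; 0; 10];
      [:: 9; 0; 1; 5; 10; 2; 4; 3; 12; 6; 9]; [:: 9; 3; 1; 2; 10]])
    (ds := [:: (1, 3, 9)])); [by [] | | by vm_compute].
by rewrite /satisfies /valuation /= !orbF !eqbF_neg -!negb_and n1 n2.
Qed.

(** The variant with three closing red edges, for even [m], with [2 + 4] blue edges. *)
Lemma pair_closing3 x t w1 w2 w3 c d W : size t = 10 -> stretch x t W ->
  uniq [:: w1; w2; w3; c; d] -> all [in W] [:: w1; w2; w3; c; d] ->
  regular x t w1 -> regular x t w2 ->
  linkedB 2 w1 w2 (belast x (take 4 t)) ||
  linkedB 6 w1 w3 (belast x t ++ [:: w2; c; d]).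
Proof.
move=> st str uw sub; rewrite /regular => n1 n2; explode t.
rewrite -[X in _ || X]orbF; apply: (stretch_check str uw sub (q := 5)
    (H := [:: [:: (false, (0, 1, 11)); (false, (1, 2, 11))];
      [:: (false, (0, 1, 12)); (false, (1, 2, 12))]])
    (gs := [:: (2, 11, 12, [:: 0; 1; 2; 3]);
      (6, 11, 13, [:: 0; 1; 2; 3; 4; 5; 6; 7; 8; 9; 12; 14; 15])])
    (reds := [:: [:: 0; 2; 11; 1; 3; 13; 6; 4; 5; 7; 9; 8; 10];
      [:: 0; 11; 3; 4; 2; 1; 12; 5; 6]; [:: 6; 14; 13; 15; 8];
      [:: 0; 11; 2; 1; 12; 3; 5; 4; 6]; [:: 0; 2; 1; 3; 12; 14; 4];
      [:: 0; 2; 1; 3; 12; 15; 5; 4; 6];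
      [:: 0; 3; 11; 7; 2; 1; 12; 4; 5; 6; 8];
      [:: 0; 3; 11; 7; 2; 1; 12; 4; 5; 15; 9; 8; 10];
      [:: 2; 7; 11; 3; 6; 5; 4; 12; 8]; [:: 0; 2; 1; 12; 3; 11; 4];
      [:: 0; 2; 1; 12; 3; 11; 5; 4; 6]; [:: 0; 11; 3; 1; 12; 2; 5; 4; 6];
      [:: 0; 3; 12; 1; 2; 11; 4]; [:: 0; 2; 1; 11; 3; 13; 6; 4; 12; 7; 8];
      [:: 0; 3; 12; 1; 2; 14; 5; 4; 6]; [:: 0; 11; 2; 15; 12; 1; 3; 13; 6];
      [:: 0; 12; 2; 1; 11; 3; 6; 4; 5; 7; 9; 8; 10];
      [:: 0; 11; 2; 3; 4; 5; 12; 1; 15; 13; 9; 8; 10];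
      [:: 0; 11; 3; 2; 4; 5; 12; 1; 6];
      [:: 0; 12; 2; 4; 3; 11; 1; 14; 7; 6; 8]; [:: 0; 2; 12; 3; 1; 15; 4];
      [:: 2; 4; 3; 6; 13; 15; 7; 12; 8]; [:: 0; 2; 12; 3; 1; 11; 4];
      [:: 6; 14; 15; 13; 8]; [:: 6; 14; 15; 13; 9; 8; 10];
      [:: 0; 3; 11; 7; 2; 1; 12; 5; 4; 14; 9; 8; 10];
      [:: 0; 11; 3; 4; 2; 14; 13; 15; 7; 6; 8]; [:: 0; 15; 12; 1; 3; 2; 4];
      [:: 0; 7; 12; 5; 4; 2; 3; 11; 1; 6; 8];
      [:: 0; 2; 12; 7; 4; 5; 6; 3; 1; 14; 8]; [:: 0; 3; 11; 2; 1; 12; 4];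
      [:: 6; 15; 7; 12; 8]; [:: 6; 14; 13; 15; 9; 8; 10];
      [:: 0; 2; 1; 3; 12; 5; 4; 15; 6];
      [:: 0; 11; 3; 6; 1; 2; 12; 4; 5; 7; 9; 8; 10];
      [:: 0; 2; 11; 3; 1; 12; 14; 13; 6]; [:: 0; 2; 11; 3; 1; 14; 12; 4; 6];
      [:: 0; 2; 11; 3; 1; 12; 14; 13; 7; 6; 8]; [:: 4; 6; 5; 15; 13; 7; 8];
      [:: 0; 12; 3; 14; 13; 15; 5; 4; 6]; [:: 0; 11; 2; 1; 12; 3; 4];
      [:: 0; 14; 3; 11; 1; 2; 12; 4; 6];
      [:: 0; 11; 3; 4; 2; 12; 15; 13; 7; 6; 8];
      [:: 0; 11; 2; 3; 4; 5; 6; 1; 12; 7; 8];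
      [:: 0; 15; 2; 4; 3; 11; 1; 14; 12; 7; 8]; [:: 6; 13; 15; 12; 9; 8; 10];
      [:: 6; 15; 13; 7; 9; 8; 10]; [:: 6; 15; 13; 14; 9; 8; 10];
      [:: 0; 15; 2; 11; 1; 12; 3; 13; 6];
      [:: 0; 11; 2; 3; 4; 5; 12; 1; 14; 7; 8];
      [:: 0; 4; 12; 14; 1; 2; 11; 3; 6]; [:: 2; 4; 3; 11; 6; 5; 7; 12; 8];
      [:: 2; 7; 11; 3; 6; 4; 5; 13; 8]; [:: 0; 12; 4; 5; 11; 2; 1; 3; 6];
      [:: 4; 6; 5; 15; 13; 14; 8]; [:: 0; 7; 2; 11; 1; 3; 12; 5; 4; 6; 8];
      [:: 0; 7; 2; 11; 1; 3; 12; 4; 5; 13; 8];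
      [:: 0; 7; 2; 11; 1; 3; 6; 5; 4; 12; 8]; [:: 6; 7; 15; 13; 9; 8; 10];
      [:: 0; 4; 12; 3; 1; 11; 2; 13; 6]; [:: 0; 4; 12; 2; 1; 11; 3; 13; 6];
      [:: 0; 13; 2; 11; 1; 3; 12; 4; 6]; [:: 2; 12; 15; 13; 5; 4; 6];
      [:: 0; 15; 1; 12; 3; 2; 4]; [:: 0; 13; 1; 12; 3; 2; 4];
      [:: 0; 11; 1; 12; 3; 2; 4]; [:: 2; 4; 3; 12; 15; 13; 6];
      [:: 0; 11; 2; 3; 4; 5; 12; 14; 1; 6; 8];
      [:: 0; 12; 4; 3; 2; 14; 7; 6; 1; 11; 8];
      [:: 0; 2; 1; 12; 15; 13; 5; 4; 6]; [:: 2; 4; 3; 14; 13; 15; 6];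
      [:: 4; 14; 13; 15; 6]; [:: 0; 12; 2; 3; 4; 5; 6; 15; 14; 1; 8];
      [:: 0; 2; 12; 4; 5; 7; 6; 3; 1; 14; 8];
      [:: 2; 7; 4; 5; 6; 11; 3; 12; 8];
      [:: 0; 13; 2; 11; 1; 12; 3; 14; 7; 6; 8];
      [:: 0; 5; 1; 11; 2; 3; 4; 12; 6];
      [:: 0; 1; 6; 5; 4; 3; 2; 11; 7; 12; 8];
      [:: 0; 6; 1; 11; 2; 3; 4; 5; 12; 7; 8];
      [:: 0; 7; 6; 5; 4; 3; 2; 11; 1; 14; 8];
      [:: 0; 7; 6; 5; 4; 3; 2; 11; 1; 12; 8];
      [:: 0; 7; 6; 5; 4; 3; 2; 12; 1; 11; 8]; [:: 6; 15; 13; 14; 8];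
      [:: 0; 15; 3; 11; 1; 12; 2; 4; 7; 6; 8];
      [:: 0; 3; 12; 2; 1; 11; 5; 4; 6];
      [:: 0; 2; 13; 15; 6; 11; 3; 7; 12; 1; 8];
      [:: 0; 4; 12; 1; 3; 11; 6; 15; 13; 2; 9; 8; 10];
      [:: 0; 12; 4; 5; 11; 3; 1; 2; 6];
      [:: 0; 6; 1; 3; 12; 5; 4; 7; 2; 11; 8];
      [:: 0; 11; 3; 4; 2; 12; 15; 13; 6]])
    (blues := [:: [:: 11; 0; 1; 3; 12]; [:: 11; 0; 1; 2; 12];
      [:: 11; 3; 0; 1; 12]; [:: 11; 2; 0; 1; 12]; [:: 11; 2; 1; 0; 12];
      [:: 11; 1; 0; 2; 12]; [:: 11; 1; 0; 3; 12]; [:: 11; 3; 1; 0; 12];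
      [:: 11; 2; 4; 7; 12; 15; 1; 5; 0; 14; 3; 6; 13];
      [:: 11; 7; 2; 5; 12; 0; 15; 4; 1; 8; 6; 3; 13];
      [:: 11; 7; 2; 5; 12; 0; 15; 4; 1; 8; 14; 6; 13];
      [:: 11; 1; 0; 4; 12; 3; 5; 6; 8; 7; 14; 2; 13];
      [:: 11; 1; 0; 4; 12; 6; 5; 9; 7; 3; 14; 8; 13];
      [:: 11; 5; 3; 7; 12; 14; 4; 8; 6; 1; 2; 9; 13];
      [:: 11; 4; 3; 5; 12; 8; 7; 14; 1; 0; 15; 9; 13];
      [:: 11; 4; 3; 5; 12; 8; 7; 14; 1; 0; 15; 6; 13];
      [:: 11; 4; 3; 5; 12; 8; 7; 14; 1; 0; 6; 2; 13];
      [:: 11; 4; 3; 5; 12; 8; 7; 14; 1; 15; 0; 2; 13];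
      [:: 11; 5; 4; 8; 12; 1; 15; 14; 6; 0; 7; 9; 13];
      [:: 11; 3; 6; 1; 12; 2; 15; 5; 9; 4; 14; 7; 13];
      [:: 11; 3; 6; 1; 12; 2; 15; 5; 9; 4; 14; 8; 13];
      [:: 11; 1; 4; 6; 12; 3; 5; 14; 2; 0; 15; 7; 13];
      [:: 11; 1; 4; 6; 12; 3; 5; 14; 2; 0; 15; 9; 13];
      [:: 11; 1; 4; 6; 12; 3; 5; 14; 2; 0; 7; 9; 13];
      [:: 11; 1; 4; 6; 12; 3; 5; 14; 2; 0; 7; 8; 13];
      [:: 11; 2; 7; 0; 12; 5; 15; 4; 6; 1; 3; 14; 13];
      [:: 11; 2; 8; 3; 12; 5; 15; 4; 6; 7; 1; 0; 13];
      [:: 11; 5; 1; 8; 12; 3; 15; 6; 7; 2; 4; 14; 13];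
      [:: 11; 5; 1; 8; 12; 3; 15; 6; 7; 2; 14; 9; 13];
      [:: 11; 2; 4; 3; 12; 14; 1; 0; 6; 7; 5; 8; 13];
      [:: 11; 2; 4; 3; 12; 14; 1; 0; 6; 7; 15; 5; 13];
      [:: 11; 2; 4; 3; 12; 14; 1; 0; 6; 7; 15; 8; 13];
      [:: 11; 8; 1; 4; 12; 9; 15; 0; 3; 7; 14; 6; 13];
      [:: 11; 2; 4; 5; 12; 0; 1; 14; 7; 15; 6; 3; 13]; [:: 11; 2; 1; 3; 12]])
    (ds := [:: (1, 2, 12); (6, 13, 14); (6, 14, 15); (2, 12, 15); (6, 7, 15);
      (7, 8, 12); (3, 6, 13); (1, 12, 14); (2, 7, 11); (3, 6, 13); (2, 7, 11);
      (0, 6, 7)])); [by [] | | by vm_compute].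
by rewrite /satisfies /valuation /= !orbF !eqbF_neg -!negb_and n1 n2.
Qed.

(** The closed form for three closing edges, again for a chain with a single pair. *)
Lemma pair_closing3_cycle x t w1 w2 c d W : size t = 10 -> stretch x t W ->
  uniq [:: w1; w2; c; d] -> all [in W] [:: w1; w2; c; d] ->
  regular x t w1 -> regular x t w2 ->
  linkedB 2 w1 w2 (belast x (take 4 t)) ||
  linkedB 6 w1 w1 (belast x t ++ [:: w2; c; d]).
Proof.
move=> st str uw sub; rewrite /regular => n1 n2; explode t.
rewrite -[X in _ || X]orbF; apply: (stretch_check str uw sub (q := 5)
    (H := [:: [:: (false, (0, 1, 11)); (false, (1, 2, 11))];
      [:: (false, (0, 1, 12)); (false, (1, 2, 12))]])
    (gs := [:: (2, 11, 12, [:: 0; 1; 2; 3]);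
      (6, 11, 11, [:: 0; 1; 2; 3; 4; 5; 6; 7; 8; 9; 12; 13; 14])])
    (reds := [:: [:: 0; 12; 3; 4; 2; 1; 11; 14; 7; 6; 8];
      [:: 0; 3; 11; 1; 2; 12; 5; 4; 6]; [:: 0; 3; 12; 1; 2; 11; 4];
      [:: 0; 2; 1; 3; 11; 13; 4]; [:: 0; 2; 1; 12; 3; 11; 4];
      [:: 0; 2; 1; 11; 3; 13; 6; 4; 5; 14; 8]; [:: 0; 3; 11; 1; 2; 14; 4];
      [:: 0; 11; 2; 3; 4; 5; 12; 1; 6];
      [:: 0; 11; 2; 4; 3; 12; 1; 14; 7; 6; 8];
      [:: 0; 11; 2; 4; 3; 1; 12; 5; 7; 6; 8];
      [:: 0; 2; 1; 12; 3; 11; 5; 4; 6]; [:: 4; 6; 7; 13; 14; 5; 8];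
      [:: 4; 12; 7; 13; 14; 5; 8]; [:: 0; 3; 11; 2; 1; 12; 14; 13; 7; 6; 8];
      [:: 6; 14; 13; 7; 9; 8; 10]; [:: 0; 7; 11; 1; 3; 2; 4; 6; 5; 14; 8];
      [:: 0; 12; 3; 4; 2; 1; 11; 5; 6];
      [:: 0; 11; 3; 2; 4; 5; 6; 1; 12; 7; 8];
      [:: 0; 12; 3; 2; 4; 5; 6; 1; 11; 7; 8];
      [:: 0; 11; 2; 3; 4; 5; 6; 1; 12; 7; 9; 8; 10];
      [:: 0; 3; 11; 2; 1; 13; 12; 4; 7; 6; 8]; [:: 0; 11; 3; 12; 1; 2; 4];
      [:: 0; 11; 2; 4; 3; 1; 12; 5; 6];
      [:: 0; 2; 1; 12; 6; 4; 5; 13; 14; 3; 8];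
      [:: 0; 2; 1; 12; 6; 4; 5; 13; 14; 3; 9; 8; 10];
      [:: 0; 11; 2; 3; 4; 5; 6; 12; 1; 14; 8];
      [:: 0; 11; 2; 4; 3; 13; 1; 12; 6];
      [:: 0; 12; 5; 6; 4; 2; 3; 11; 1; 14; 8];
      [:: 4; 6; 5; 14; 13; 12; 9; 8; 10]; [:: 4; 6; 5; 14; 13; 7; 9; 8; 10];
      [:: 0; 14; 4; 2; 3; 11; 1; 12; 6]; [:: 0; 5; 11; 1; 2; 4; 3; 12; 6];
      [:: 0; 5; 11; 3; 1; 2; 12; 4; 7; 6; 8];
      [:: 0; 2; 1; 6; 12; 4; 7; 11; 3; 14; 8];
      [:: 0; 7; 11; 3; 1; 12; 6; 5; 4; 2; 9; 8; 10];
      [:: 0; 11; 1; 12; 3; 2; 4]])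
    (blues := [:: [:: 11; 2; 0; 1; 12]; [:: 11; 2; 1; 3; 12];
      [:: 11; 2; 1; 0; 12]; [:: 11; 0; 1; 3; 12]; [:: 11; 0; 1; 2; 12];
      [:: 11; 1; 0; 3; 12]; [:: 11; 3; 0; 1; 12]; [:: 11; 3; 1; 0; 12];
      [:: 11; 6; 5; 4; 12; 13; 9; 3; 14; 1; 7; 0; 11];
      [:: 11; 6; 5; 4; 12; 13; 9; 3; 14; 1; 7; 8; 11];
      [:: 11; 1; 6; 3; 12; 5; 2; 4; 9; 13; 7; 14; 11];
      [:: 11; 0; 1; 6; 12; 7; 5; 8; 14; 2; 4; 13; 11];
      [:: 11; 4; 2; 5; 12; 1; 6; 3; 13; 9; 7; 14; 11];
      [:: 11; 4; 2; 5; 12; 1; 6; 3; 13; 14; 7; 0; 11];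
      [:: 11; 3; 7; 9; 12; 13; 1; 2; 4; 14; 0; 5; 11];
      [:: 11; 3; 5; 0; 12; 1; 14; 13; 6; 7; 4; 2; 11];
      [:: 11; 0; 5; 6; 12; 7; 8; 14; 3; 1; 13; 4; 11];
      [:: 11; 3; 4; 7; 12; 6; 5; 13; 14; 8; 1; 0; 11]])
    (ds := [:: (1, 3, 12); (1, 6, 12); (0, 5, 11)])); [by [] | | by vm_compute].
by rewrite /satisfies /valuation /= !orbF !eqbF_neg -!negb_and n1 n2.
Qed.

(** * Reversal of paths, and the trade of the closing edges *)

Lemma lpath_rev (r0 : T -> T -> T -> bool) x y s : symmetric3 r0 -> odd (size s) ->
  lpath r0 x (rcons s y) -> lpath r0 y (rcons (rev s) x).
Proof.
move=> [r12 r23]; have [n] := ubnP (size s).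
elim: n x s => // n IH x [|a [|b s]] //= sz od.
  by rewrite !andbT r12 r23 r12.
rewrite negbK in od => /andP[rab ps].
have -> : rcons (rev [:: a, b & s]) x = rcons (rev s) b ++ [:: a; x].
  by rewrite !rev_cons -!cats1 -!catA.
rewrite lpath_cat ?size_rcons ?size_rev /= ?od // last_rcons IH //=.
  by rewrite r12 r23 r12 rab.
by rewrite !ltnS in sz; apply: leq_trans sz.
Qed.

Lemma colour_sym (r0 : T -> T -> T -> bool) k :
  symmetric3 r0 -> symmetric3 (colour r0 k).
Proof. by case=> r12 r23; case: k => //; split=> x y z /=; congr (~~ _). Qed.

(** Reversal makes [x] one of the listed vertices, hence the requirement that [x] does not occur
    among the admissible ones. *)
Lemma linked_rev (r0 : T -> T -> T -> bool) L x y s : symmetric3 r0 ->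
  0 < L -> x \notin y :: s -> linked r0 L x y s -> linked r0 L y x s.
Proof.
move=> r3 L0 xs /linkedP[p [sz up lp sub pp]].
case/lastP: p => [|p z] in sz up lp sub pp; first by move: sz L0; case: L.
rewrite last_rcons in lp; rewrite {z}lp in sz up sub pp.
move: up; rewrite rcons_uniq size_rcons in sz * => /andP[yp up].
apply/linkedP; exists (rcons (rev p) x); split.
- by rewrite size_rcons size_rev.
- rewrite rcons_uniq rev_uniq mem_rev up andbT; apply: contra xs => xp.
  by apply: sub; rewrite mem_rcons inE xp orbT.
- by rewrite last_rcons.
- move=> u; rewrite mem_rcons !inE mem_rev => /predU1P[->|up']; first by rewrite eqxx.
  have := sub u; rewrite mem_rcons !inE up' orbT => /(_ isT).
  by case/predU1P=> [uy|->]; [rewrite -uy up' in yp | rewrite orbT].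
- by apply: lpath_rev => //; lia.
Qed.

(** The final trade of [k] red edges for one blue edge more, with arbitrary ends [a], [b] and
    helpers [c], [d]. The last vertex of [t] stays free, since it is the first vertex of the chain
    when the chain runs once around the cycle. *)
Definition closes k x t W :=
  [forall a, forall b, forall c, forall d,
    uniq [:: a; b; c; d] && all [in W] [:: a; b; c; d] ==>
    linkedB k.+1 a b (belast x t ++ [:: c; d])].

Lemma closesPn k x t W : reflect
  (exists a b c d, [/\ uniq [:: a; b; c; d], all [in W] [:: a; b; c; d] &
     ~~ linkedB k.+1 a b (belast x t ++ [:: c; d])]) (~~ closes k x t W).
Proof.
apply: (iffP forallPn) => [[a /forallPn[b /forallPn[c /forallPn[d]]]]|].
  by rewrite negb_imply => /andP[/andP[u s] n]; exists a, b, c, d.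
case=> a [b [c [d [u s n]]]]; exists a; apply/forallPn; exists b.
apply/forallPn; exists c; apply/forallPn; exists d.
by rewrite negb_imply u s.
Qed.

Lemma closesP k x t W a b c d : closes k x t W ->
  uniq [:: a; b; c; d] -> all [in W] [:: a; b; c; d] ->
  linkedB k.+1 a b (belast x t ++ [:: c; d]).
Proof.
move=> /forallP/(_ a)/forallP/(_ b)/forallP/(_ c)/forallP/(_ d)/implyP cl u s.
by rewrite cl // u.
Qed.

(* Let [P a b c d] hold whenever the labels [a], [b], [c], [d] do not close the
   stretch; by symmetry it suffices to reach [a], [c] and fresh labels. *)
Lemma label_cases k x t W (P : T -> Prop) a b c d e : stretch x t W ->
  uniq [:: a; b; c; d] -> all [in W] [:: a; b; c; d] -> e \in W ->
  ~~ linkedB k.+1 a b (belast x t ++ [:: c; d]) ->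
  (forall a b c d, uniq [:: a; b; c; d] -> all [in W] [:: a; b; c; d] ->
     ~~ linkedB k.+1 a b (belast x t ++ [:: c; d]) -> P a /\ P c) ->
  (uniq [:: a; b; c; d; e] -> P e) -> P e.
Proof.
move=> [_ u2 _ _] u s eW n Pac Pe.
have aS : a \notin b :: belast x t ++ [:: c; d].
  move: u2 u; rewrite cat_uniq => /and3P[_ /hasPn dW _] /= /and4P[].
  rewrite !inE mem_cat !inE !negb_or => /and3P[-> -> ->] _ _ _; rewrite !andbT /=.
  by apply: dW; case/andP: s.
have swap : ~~ linkedB k.+1 b a (belast x t ++ [:: c; d]).
  apply: contra n; apply: linked_rev => //; first exact: colour_sym.
  move: u2 u; rewrite cat_uniq => /and3P[_ /hasPn dW _] /= /and4P[].
  rewrite !inE mem_cat !inE !negb_or => /and3P[ab _ _] /andP[-> ->] _ _.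
  by rewrite !andbT eq_sym ab /=; apply: dW; case/and3P: s.
have swap' : ~~ linkedB k.+1 a b (belast x t ++ [:: d; c]).
  by apply: contra n; apply: linked_sub => z; rewrite !mem_cat !inE [(z == d) || _]orbC.
have [->|ea] := eqVneq e a; first by case: (Pac _ _ _ _ u s n).
have [->|eb] := eqVneq e b.
  case: (Pac b a c d) => //; last by move: s => /= /and5P[-> -> -> ->].
  move: u => /= /and4P[]; rewrite !inE !negb_or => /and3P[ab -> ->] /andP[-> ->] -> _.
  by rewrite eq_sym ab.
have [->|ec] := eqVneq e c; first by case: (Pac _ _ _ _ u s n).
have [->|ed] := eqVneq e d.
  case: (Pac a b d c) => //; last by move: s => /= /and5P[-> -> -> ->].
  move: u => /= /and4P[]; rewrite !inE !negb_or => /and3P[-> -> ->] /andP[-> ->].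
  by rewrite [d == c]eq_sym => -> .
apply: Pe; move: u => /= /and4P[].
rewrite !inE !negb_or => /and3P[-> -> ->] /andP[-> ->] -> _.
by rewrite ![_ == e]eq_sym ea eb ec ed.
Qed.

(** Meant to clash with [not_closing2_blue]: for stretches that overlap in one edge, the same triple
    would be both red and blue. *)
Lemma not_closing2_red x t a b c d W : size t = 4 -> stretch x t W ->
  uniq [:: a; b; c; d] -> all [in W] [:: a; b; c; d] ->
  ~~ linkedB 3 a b (belast x t ++ [:: c; d]) -> r (nth x t 0) (nth x t 1) a.
Proof.
move=> st str uw sub; apply: contraNT => n1; explode t.
rewrite -[linkedB _ _ _ _]orbF; apply: (stretch_check str uw sub (q := 2)
    (H := [:: [:: (false, (1, 2, 5))]])
    (gs := [:: (3, 5, 6, [:: 0; 1; 2; 3; 7; 8])])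
    (reds := [:: [:: 0; 7; 6; 8; 3; 2; 4]; [:: 0; 6; 7; 8; 2];
      [:: 0; 8; 1; 7; 3; 2; 4]])
    (blues := [:: [:: 5; 2; 1; 8; 0; 7; 6]; [:: 5; 2; 1; 3; 7; 0; 6];
      [:: 5; 1; 2; 7; 8; 3; 6]])
    (ds := [:: (0, 6, 7)])); [by [] | | by vm_compute].
by rewrite /satisfies /valuation /= !orbF eqbF_neg n1.
Qed.

(** By [label_cases] it suffices to treat [e = a], [e = c] and a fresh [e]; each case has its own
    certificate. *)
Lemma not_closing2_blue x t a b c d W : size t = 4 -> stretch x t W ->
  uniq [:: a; b; c; d] -> all [in W] [:: a; b; c; d] ->
  ~~ linkedB 3 a b (belast x t ++ [:: c; d]) ->
  {in W, forall e, ~~ r (nth x t 2) (nth x t 3) e}.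
Proof.
move=> st str uw sub n e eW; apply: (label_cases
    (P := fun e => ~~ r (nth x t 2) (nth x t 3) e) str uw sub eW n) =>
    [a1 b1 c1 d1 u1 s1 n2|u1].
  split; apply: contra n2 => n1; explode t.
    rewrite -[linkedB _ _ _ _]orbF; apply: (stretch_check str u1 s1 (q := 2)
      (H := [:: [:: (true, (3, 4, 5))]])
      (gs := [:: (3, 5, 6, [:: 0; 1; 2; 3; 7; 8])])
    (reds := [:: [:: 2; 8; 5; 3; 4]; [:: 2; 7; 3; 5; 4];
      [:: 0; 2; 1; 6; 3; 5; 4]])
    (blues := [:: [:: 5; 8; 2; 7; 3; 1; 6]])
    (ds := [::])); [by [] | | by vm_compute].
    by rewrite /satisfies /valuation /= !orbF n1.
  rewrite -[linkedB _ _ _ _]orbF; apply: (stretch_check str u1 s1 (q := 2)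
      (H := [:: [:: (true, (3, 4, 7))]])
      (gs := [:: (3, 5, 6, [:: 0; 1; 2; 3; 7; 8])])
    (reds := [:: [:: 2; 5; 7; 3; 4]; [:: 2; 8; 3; 7; 4];
      [:: 0; 2; 1; 6; 3; 7; 4]])
    (blues := [:: [:: 5; 7; 2; 8; 3; 1; 6]])
    (ds := [::])); [by [] | | by vm_compute].
  by rewrite /satisfies /valuation /= !orbF n1.
(* The fresh vertex has the index [9], which the blue goal does not admit: it serves red detours
   only. *)
apply: contra n => n1; explode t.
rewrite -[linkedB _ _ _ _]orbF; apply: (stretch_check str u1 _ (q := 2)
      (H := [:: [:: (true, (3, 4, 9))]])
      (gs := [:: (3, 5, 6, [:: 0; 1; 2; 3; 7; 8])])
    (reds := [:: [:: 0; 2; 1; 5; 3; 9; 4]; [:: 2; 8; 3; 9; 4];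
      [:: 0; 8; 6; 7; 2]])
    (blues := [:: [:: 5; 1; 3; 8; 2; 7; 6]; [:: 5; 1; 3; 2; 8; 0; 6]])
    (ds := [::])); [ | by [] | | by vm_compute].
  by move: sub => /= /and5P[-> -> -> -> _]; rewrite eW.
by rewrite /satisfies /valuation /= !orbF n1.
Qed.

(** The analogue for three edges, again by [label_cases]. The blue triples obtained become clauses
    in [closes3_shift]. *)
Lemma not_closing3_blue x t a b c d W : size t = 6 -> stretch x t W ->
  uniq [:: a; b; c; d] -> all [in W] [:: a; b; c; d] ->
  ~~ linkedB 4 a b (belast x t ++ [:: c; d]) ->
  {in W, forall e, ~~ r (nth x t 1) (nth x t 2) e /\ ~~ r (nth x t 0) (nth x t 2) e}.
Proof.
move=> st str uw sub n e eW; split.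
  apply: (label_cases (P := fun e => ~~ r (nth x t 1) (nth x t 2) e)
    str uw sub eW n) =>
    [a1 b1 c1 d1 u1 s1 n2|u1].
    split; apply: contra n2 => n1; explode t.
      rewrite -[linkedB _ _ _ _]orbF; apply: (stretch_check str u1 s1 (q := 3)
        (H := [:: [:: (true, (2, 3, 7))]])
        (gs := [:: (4, 7, 8, [:: 0; 1; 2; 3; 4; 5; 9; 10])])
    (reds := [:: [:: 2; 7; 3; 8; 5; 4; 6]; [:: 2; 3; 7; 9; 4];
      [:: 0; 10; 3; 7; 2; 1; 4]; [:: 2; 7; 3; 9; 5; 4; 6];
      [:: 0; 1; 8; 10; 2]; [:: 0; 1; 3; 7; 2; 10; 4];
      [:: 0; 10; 3; 7; 2; 1; 5; 4; 6]])
    (blues := [:: [:: 7; 9; 4; 2; 1; 0; 3; 5; 8];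
      [:: 7; 9; 4; 10; 2; 1; 5; 3; 8]; [:: 7; 4; 9; 5; 3; 0; 10; 2; 8];
      [:: 7; 4; 9; 5; 3; 10; 0; 1; 8]])
    (ds := [:: (0, 3, 10)])); [by [] | | by vm_compute].
      by rewrite /satisfies /valuation /= !orbF n1.
    rewrite -[linkedB _ _ _ _]orbF; apply: (stretch_check str u1 s1 (q := 3)
        (H := [:: [:: (true, (2, 3, 9))]])
        (gs := [:: (4, 7, 8, [:: 0; 1; 2; 3; 4; 5; 9; 10])])
    (reds := [:: [:: 2; 3; 9; 10; 5; 4; 6]; [:: 2; 9; 3; 7; 5; 4; 6];
      [:: 2; 9; 3; 10; 4]; [:: 0; 8; 2; 3; 9; 1; 4];
      [:: 0; 8; 9; 3; 2; 7; 5; 4; 6]; [:: 2; 9; 3; 8; 4];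
      [:: 0; 9; 3; 10; 2; 1; 4]; [:: 2; 3; 10; 7; 4];
      [:: 0; 7; 9; 3; 2; 1; 4]])
    (blues := [:: [:: 7; 2; 5; 10; 9; 1; 4; 3; 8];
      [:: 7; 5; 3; 10; 4; 1; 2; 0; 8]; [:: 7; 5; 3; 10; 4; 1; 9; 0; 8];
      [:: 7; 4; 10; 5; 9; 3; 0; 2; 8]; [:: 7; 0; 9; 5; 10; 2; 3; 4; 8]])
    (ds := [:: (1, 4, 9)])); [by [] | | by vm_compute].
    by rewrite /satisfies /valuation /= !orbF n1.
  apply: contra n => n1; explode t.
  rewrite -[linkedB _ _ _ _]orbF; apply: (stretch_check str u1 _ (q := 3)
        (H := [:: [:: (true, (2, 3, 11))]])
        (gs := [:: (4, 7, 8, [:: 0; 1; 2; 3; 4; 5; 9; 10])])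
    (reds := [:: [:: 2; 11; 3; 8; 5; 4; 6]; [:: 2; 11; 3; 10; 4];
      [:: 2; 11; 3; 9; 4]; [:: 0; 10; 7; 1; 2]; [:: 0; 10; 7; 9; 2];
      [:: 0; 1; 9; 8; 2]; [:: 0; 7; 10; 1; 9; 2; 4];
      [:: 0; 1; 3; 11; 2; 9; 4]; [:: 0; 9; 1; 7; 2]])
    (blues := [:: [:: 7; 1; 2; 9; 4; 10; 3; 5; 8];
      [:: 7; 2; 9; 1; 10; 4; 3; 5; 8]; [:: 7; 10; 0; 1; 9; 4; 3; 5; 8];
      [:: 7; 10; 0; 1; 3; 4; 9; 2; 8]])
    (ds := [:: (0, 1, 9)])); [ | by [] | | by vm_compute].
    by move: sub => /= /and5P[-> -> -> -> _]; rewrite eW.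
  by rewrite /satisfies /valuation /= !orbF n1.
apply: (label_cases (P := fun e => ~~ r (nth x t 0) (nth x t 2) e)
    str uw sub eW n) =>
    [a1 b1 c1 d1 u1 s1 n2|u1].
  split; apply: contra n2 => n1; explode t.
    rewrite -[linkedB _ _ _ _]orbF; apply: (stretch_check str u1 s1 (q := 3)
        (H := [:: [:: (true, (1, 3, 7))]])
        (gs := [:: (4, 7, 8, [:: 0; 1; 2; 3; 4; 5; 9; 10])])
    (reds := [:: [:: 0; 2; 1; 7; 3; 10; 4]; [:: 0; 2; 1; 7; 3; 8; 5; 4; 6];
      [:: 0; 9; 7; 1; 3; 2; 4]; [:: 0; 10; 1; 7; 3; 2; 4]])
    (blues := [:: [:: 7; 9; 0; 1; 10; 4; 3; 5; 8]])
    (ds := [::])); [by [] | | by vm_compute].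
    by rewrite /satisfies /valuation /= !orbF n1.
  rewrite -[linkedB _ _ _ _]orbF; apply: (stretch_check str u1 s1 (q := 3)
        (H := [:: [:: (true, (1, 3, 9))]])
        (gs := [:: (4, 7, 8, [:: 0; 1; 2; 3; 4; 5; 9; 10])])
    (reds := [:: [:: 0; 2; 1; 9; 3; 10; 4]; [:: 0; 2; 1; 9; 3; 8; 5; 4; 6];
      [:: 0; 7; 9; 1; 3; 2; 4]; [:: 0; 10; 1; 9; 3; 2; 4]])
    (blues := [:: [:: 7; 9; 0; 1; 10; 4; 3; 5; 8]])
    (ds := [::])); [by [] | | by vm_compute].
  by rewrite /satisfies /valuation /= !orbF n1.
apply: contra n => n1; explode t.
rewrite -[linkedB _ _ _ _]orbF; apply: (stretch_check str u1 _ (q := 3)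
        (H := [:: [:: (true, (1, 3, 11))]])
        (gs := [:: (4, 7, 8, [:: 0; 1; 2; 3; 4; 5; 9; 10])])
    (reds := [:: [:: 0; 2; 1; 11; 3; 8; 5; 4; 6]; [:: 0; 2; 1; 11; 3; 10; 4];
      [:: 0; 9; 10; 1; 2]; [:: 0; 10; 9; 7; 3; 2; 4];
      [:: 0; 8; 1; 11; 3; 2; 4]; [:: 0; 7; 1; 11; 3; 2; 4]])
    (blues := [:: [:: 7; 9; 3; 4; 10; 2; 1; 0; 8];
      [:: 7; 1; 0; 9; 10; 4; 3; 5; 8]])
    (ds := [::])); [ | by [] | | by vm_compute].
  by move: sub => /= /and5P[-> -> -> -> _]; rewrite eW.
by rewrite /satisfies /valuation /= !orbF n1.
Qed.

(** If both stretches failed, the triple of [v3], [v4] and [a'] would be blue by the first one and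
    red by the second one. *)
Lemma closes2_shift x t W : size t = 6 -> stretch x t W ->
  closes 2 x (take 4 t) W || closes 2 (last x (take 2 t)) (drop 2 t) W.
Proof.
case: t => [|v1 [|v2 [|v3 [|v4 [|v5 [|v6 [|]]]]]]] //= _ str.
have str1 := @stretch_catl x [:: v1; v2; v3; v4] [:: v5; v6] W isT str.
have str2 := @stretch_catr x [:: v1; v2] [:: v3; v4; v5; v6] W isT str.
have [//|/closesPn[a [b [c [d [u s n]]]]] /=] := boolP (closes 2 x _ W).
apply/negPn/negP => /closesPn[a' [b' [c' [d' [u' s' n']]]]].
have /negP[] : ~~ r v3 v4 a'.
  by apply: (not_closing2_blue _ str1 u s n) => //; case/andP: s'.
exact: not_closing2_red _ str2 u' s' n'.
Qed.

(** If the later stretch fails, then [v4], [v5] as well as [v3], [v5] form blue triples with [c] and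
    with [d]. These four triples let the earlier stretch close between [a] and [b]. *)
Lemma closes3_shift x t W : size t = 8 -> stretch x t W ->
  closes 3 x (take 6 t) W || closes 3 (last x (take 2 t)) (drop 2 t) W.
Proof.
case: t => [|v1 [|v2 [|v3 [|v4 [|v5 [|v6 [|v7 [|v8 [|]]]]]]]]] //= _ str.
have str2 := @stretch_catr x [:: v1; v2] [:: v3; v4; v5; v6; v7; v8] W isT str.
rewrite orbC; have [//|/closesPn[a' [b' [c' [d' [u' s' n']]]]] /=] :=
  boolP (closes 3 v2 _ W).
have blueW := not_closing3_blue _ str2 u' s' n'.
apply/negPn/negP => /closesPn[a [b [c [d [u s]]]]]; apply/negP/negPn.
have [bc1 bc2] : ~~ r v4 v5 c /\ ~~ r v3 v5 c.
  by apply: blueW => //; case/and5P: s.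
have [bd1 bd2] : ~~ r v4 v5 d /\ ~~ r v3 v5 d.
  by apply: blueW => //; case/and5P: s.
rewrite -[linkedB _ _ _ _]orbF; apply: (stretch_check str u s (q := 4)
    (H := [:: [:: (false, (4, 5, 11))]; [:: (false, (3, 5, 11))];
              [:: (false, (4, 5, 12))]; [:: (false, (3, 5, 12))]])
    (gs := [:: (4, 9, 10, [:: 0; 1; 2; 3; 4; 5; 11; 12])])
    (reds := [:: [:: 0; 2; 1; 10; 3; 9; 5; 4; 6]; [:: 2; 12; 9; 3; 5; 4; 6];
      [:: 0; 11; 10; 1; 2]; [:: 0; 1; 12; 9; 2]; [:: 0; 12; 1; 10; 3; 2; 4];
      [:: 0; 11; 10; 1; 3; 2; 4]])
    (blues := [:: [:: 9; 2; 12; 4; 5; 11; 3; 1; 10];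
      [:: 9; 3; 5; 4; 12; 0; 1; 2; 10]; [:: 9; 3; 5; 4; 12; 1; 0; 11; 10]])
    (ds := [:: (2, 9, 12)])); [by [] | | by vm_compute].
by rewrite /satisfies /valuation /= !orbF !eqbF_neg bc1 bc2 bd1 bd2.
Qed.

Lemma blue_triangle x t a b c W : size t = 6 -> stretch x t W ->
  uniq [:: a; b; c] -> all [in W] [:: a; b; c] ->
  [|| linkedB 3 a a (belast x t ++ [:: b; c]),
      linkedB 3 b b (belast x t ++ [:: a; c]) |
      linkedB 3 c c (belast x t ++ [:: a; b])].
Proof.
move=> st str uw sub; explode t.
rewrite -[linkedB 3 c c _]orbF; apply: (stretch_check str uw sub (q := 3)
    (H := [::])
    (gs := [:: (3, 7, 7, [:: 0; 1; 2; 3; 4; 5; 8; 9]);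
      (3, 8, 8, [:: 0; 1; 2; 3; 4; 5; 7; 9]);
      (3, 9, 9, [:: 0; 1; 2; 3; 4; 5; 7; 8])])
    (reds := [:: [:: 0; 8; 9; 7; 2]; [:: 2; 9; 7; 8; 5; 4; 6];
      [:: 0; 2; 1; 9; 8; 7; 4]; [:: 0; 2; 1; 3; 7; 8; 4];
      [:: 0; 2; 1; 7; 3; 9; 4]; [:: 0; 1; 7; 9; 2]; [:: 0; 2; 1; 8; 9; 3; 4]])
    (blues := [:: [:: 7; 1; 0; 9; 8; 5; 7]; [:: 7; 2; 9; 8; 1; 3; 7];
      [:: 7; 8; 4; 3; 9; 2; 7]])
    (ds := [:: (2, 7, 9); (1, 8, 9)])); by [|vm_compute].
Qed.

(** The same for [m = 4], with four red edges and still three vertices off the cycle. *)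
Lemma blue_quadrangle x t a b c W : size t = 8 -> stretch x t W ->
  uniq [:: a; b; c] -> all [in W] [:: a; b; c] ->
  [|| linkedB 4 a a (belast x t ++ [:: b; c]),
      linkedB 4 b b (belast x t ++ [:: a; c]) |
      linkedB 4 c c (belast x t ++ [:: a; b])].
Proof.
move=> st str uw sub; explode t.
rewrite -[linkedB 4 c c _]orbF; apply: (stretch_check str uw sub (q := 4)
    (H := [::])
    (gs := [:: (4, 9, 9, [:: 0; 1; 2; 3; 4; 5; 6; 7; 10; 11]);
      (4, 10, 10, [:: 0; 1; 2; 3; 4; 5; 6; 7; 9; 11]);
      (4, 11, 11, [:: 0; 1; 2; 3; 4; 5; 6; 7; 9; 10])])
    (reds := [:: [:: 4; 10; 9; 5; 6]; [:: 2; 10; 9; 3; 5; 4; 6];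
      [:: 2; 10; 9; 11; 5; 4; 6]; [:: 2; 4; 3; 9; 10; 11; 7; 6; 8];
      [:: 4; 5; 10; 11; 7; 6; 8]; [:: 4; 10; 5; 9; 7; 6; 8];
      [:: 4; 10; 5; 9; 6]; [:: 2; 10; 9; 11; 4]; [:: 2; 11; 9; 3; 4];
      [:: 0; 2; 1; 3; 11; 9; 4]; [:: 0; 2; 1; 11; 3; 9; 4];
      [:: 2; 11; 9; 10; 5; 4; 6]; [:: 2; 9; 10; 11; 4]; [:: 2; 9; 11; 10; 4];
      [:: 4; 11; 5; 10; 6]; [:: 0; 2; 1; 3; 11; 10; 4];
      [:: 0; 2; 1; 11; 10; 9; 4]; [:: 4; 10; 9; 11; 7; 6; 8];
      [:: 4; 5; 10; 9; 7; 6; 8]; [:: 4; 5; 11; 9; 7; 6; 8];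
      [:: 2; 4; 3; 11; 5; 10; 6]; [:: 2; 9; 10; 3; 4];
      [:: 0; 2; 1; 11; 3; 10; 4]; [:: 0; 2; 1; 9; 5; 4; 3; 10; 6];
      [:: 0; 2; 1; 11; 9; 5; 10; 3; 6];
      [:: 0; 2; 1; 10; 5; 4; 3; 11; 7; 6; 8];
      [:: 0; 2; 1; 4; 11; 9; 10; 5; 6];
      [:: 0; 2; 1; 4; 10; 9; 5; 11; 7; 6; 8]; [:: 4; 5; 9; 11; 7; 6; 8];
      [:: 4; 5; 9; 10; 7; 6; 8]; [:: 0; 11; 10; 1; 2];
      [:: 0; 10; 11; 1; 3; 2; 4]; [:: 0; 11; 10; 9; 2];
      [:: 0; 2; 1; 11; 10; 9; 5; 4; 6]; [:: 0; 9; 5; 10; 1; 11; 3; 4; 6];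
      [:: 0; 5; 9; 10; 2; 4; 3; 11; 7; 6; 8];
      [:: 0; 9; 5; 11; 4; 2; 3; 10; 6]; [:: 4; 11; 5; 9; 6];
      [:: 4; 5; 11; 10; 6]; [:: 4; 10; 11; 5; 7; 6; 8];
      [:: 2; 4; 3; 9; 10; 11; 6]; [:: 4; 9; 11; 10; 6];
      [:: 0; 9; 3; 4; 2; 5; 1; 10; 7; 6; 8]; [:: 2; 4; 3; 5; 11; 10; 6];
      [:: 2; 4; 3; 9; 5; 11; 7; 6; 8]; [:: 2; 4; 3; 10; 5; 9; 6];
      [:: 2; 4; 3; 5; 10; 11; 6]; [:: 0; 2; 1; 11; 9; 3; 4];
      [:: 0; 9; 5; 1; 4; 2; 3; 10; 6]; [:: 0; 9; 3; 2; 4; 5; 1; 11; 6];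
      [:: 0; 9; 3; 11; 1; 10; 5; 4; 6]; [:: 0; 10; 9; 11; 2];
      [:: 4; 9; 10; 5; 6]; [:: 0; 5; 9; 10; 4; 3; 2; 1; 6];
      [:: 4; 10; 9; 11; 6]; [:: 0; 3; 9; 2; 10; 5; 1; 11; 6];
      [:: 0; 3; 9; 2; 10; 1; 5; 4; 6]; [:: 0; 11; 1; 10; 2];
      [:: 0; 2; 9; 3; 10; 1; 4]; [:: 0; 1; 11; 9; 2];
      [:: 2; 9; 11; 3; 5; 4; 6]; [:: 0; 2; 1; 10; 11; 3; 5; 4; 6];
      [:: 0; 11; 1; 5; 10; 2; 9; 4; 6]; [:: 2; 11; 4; 9; 10; 3; 6];
      [:: 0; 11; 1; 4; 2; 9; 10; 3; 6]; [:: 0; 11; 1; 5; 10; 9; 2; 4; 6];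
      [:: 0; 11; 1; 5; 9; 4; 10; 3; 7; 6; 8];
      [:: 0; 10; 11; 1; 9; 3; 5; 4; 6]; [:: 0; 9; 1; 11; 3; 2; 4];
      [:: 0; 2; 1; 10; 11; 3; 4]; [:: 0; 1; 9; 5; 4; 2; 3; 10; 6];
      [:: 0; 9; 10; 1; 5; 2; 3; 11; 7; 6; 8]; [:: 0; 2; 1; 9; 11; 10; 4];
      [:: 0; 1; 9; 10; 2]; [:: 0; 1; 9; 10; 3; 2; 4];
      [:: 0; 9; 5; 11; 4; 3; 2; 1; 6]; [:: 0; 10; 11; 5; 4; 9; 1; 2; 6];
      [:: 0; 11; 10; 3; 5; 9; 1; 2; 6]; [:: 0; 9; 1; 10; 2];
      [:: 0; 2; 1; 5; 4; 11; 3; 9; 6]; [:: 4; 9; 5; 11; 6];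
      [:: 2; 4; 3; 9; 5; 11; 6]; [:: 0; 1; 9; 11; 2];
      [:: 0; 2; 4; 5; 1; 9; 11; 10; 6]; [:: 0; 9; 1; 5; 4; 2; 3; 10; 6];
      [:: 0; 1; 10; 9; 3; 2; 4]; [:: 0; 1; 11; 10; 3; 2; 4];
      [:: 0; 2; 1; 3; 9; 10; 4]; [:: 0; 11; 1; 9; 3; 2; 4]])
    (blues := [:: [:: 9; 2; 10; 7; 11; 5; 3; 4; 9];
      [:: 9; 2; 10; 6; 11; 3; 4; 5; 9]; [:: 9; 2; 10; 6; 11; 3; 1; 0; 9];
      [:: 9; 2; 10; 6; 11; 3; 1; 5; 9]; [:: 9; 4; 10; 0; 11; 7; 3; 5; 9];
      [:: 9; 3; 10; 0; 11; 7; 5; 4; 9]; [:: 9; 3; 10; 0; 11; 7; 5; 6; 9];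
      [:: 9; 10; 3; 11; 1; 2; 6; 5; 9]; [:: 9; 10; 3; 11; 1; 2; 5; 7; 9];
      [:: 9; 0; 5; 6; 10; 1; 7; 11; 9]; [:: 9; 0; 5; 6; 10; 1; 11; 7; 9];
      [:: 9; 0; 5; 6; 10; 1; 11; 4; 9]; [:: 9; 1; 5; 10; 4; 2; 6; 11; 9];
      [:: 9; 1; 5; 10; 4; 2; 0; 3; 9]; [:: 9; 6; 4; 2; 11; 3; 10; 7; 9];
      [:: 9; 3; 0; 1; 11; 4; 10; 7; 9]; [:: 9; 3; 0; 1; 11; 4; 10; 5; 9];
      [:: 9; 3; 0; 1; 11; 4; 5; 6; 9]; [:: 9; 3; 0; 1; 11; 7; 10; 4; 9];
      [:: 9; 4; 3; 5; 11; 6; 1; 0; 9]; [:: 9; 4; 3; 5; 11; 6; 10; 0; 9];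
      [:: 9; 5; 3; 6; 10; 1; 2; 11; 9]; [:: 9; 5; 3; 6; 10; 1; 4; 11; 9];
      [:: 9; 5; 3; 6; 10; 1; 0; 2; 9]; [:: 9; 0; 1; 5; 10; 3; 4; 11; 9];
      [:: 9; 0; 5; 3; 4; 1; 2; 11; 9]; [:: 9; 0; 5; 3; 4; 1; 10; 11; 9];
      [:: 9; 0; 5; 3; 4; 1; 11; 2; 9]; [:: 9; 2; 10; 3; 5; 4; 1; 0; 9];
      [:: 9; 2; 10; 3; 5; 4; 11; 1; 9]; [:: 9; 7; 11; 6; 5; 10; 3; 0; 9];
      [:: 9; 7; 11; 6; 5; 10; 4; 3; 9]; [:: 9; 7; 11; 6; 5; 10; 4; 1; 9];
      [:: 9; 6; 3; 2; 5; 4; 10; 11; 9]; [:: 9; 10; 5; 3; 4; 0; 2; 11; 9];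
      [:: 9; 1; 3; 7; 10; 6; 5; 11; 9]; [:: 9; 2; 10; 11; 4; 1; 5; 3; 9];
      [:: 9; 2; 10; 11; 4; 6; 3; 1; 9]])
    (ds := [:: (2, 9, 11); (2, 9, 10); (7, 9, 10); (3, 6, 10); (3, 7, 11);
      (3, 9, 10); (4, 9, 10); (1, 3, 11); (4, 5, 9); (1, 4, 10); (3, 4, 11);
      (4, 5, 11); (3, 5, 10); (3, 5, 9); (1, 2, 10)])); by [|vm_compute].
Qed.

End Stretches.

(** * Joining the blue pieces *)

Section LooseCycles.

Variable T : finType.
Implicit Types (x y z w a b c d : T) (s t p ls S W : seq T).
Implicit Type r : T -> T -> T -> bool.

Lemma linked_cat r L1 L2 x y z s1 s2 :
  uniq ((y :: s1) ++ (z :: s2)) -> linked r L1 x y s1 -> linked r L2 y z s2 ->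
  linked r (L1 + L2) x z (s1 ++ y :: s2).
Proof.
rewrite cat_uniq => /and3P[_ /hasPn dis _] /linkedP[p [szp up lp subp pp]].
move=> /linkedP[q [szq uq lq subq pq]].
apply/linkedP; exists (p ++ q); split.
- by rewrite size_cat szp szq mulnDr.
- rewrite cat_uniq up uq andbT; apply/hasPn => u /subq/dis; apply: contra.
  exact: subp.
- by rewrite last_cat lp.
- move=> u; rewrite mem_cat !inE mem_cat inE => /orP[/subp|/subq]; rewrite !inE.
    by case/orP=> ->; rewrite ?orbT.
  by case/orP=> ->; rewrite ?orbT.
- by rewrite lpath_cat ?pp ?lp // szp mul2n odd_double.
Qed.

(** In use, [s1] and [s2] come from the red cycle while [ls1] and [ls2] are labels off it; keeping
    them apart gives the shape of the conclusion of [chain]. *)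
Lemma linked_glue r L1 L2 w y z s1 s2 ls1 ls2 :
  uniq ((s1 ++ s2) ++ z :: ls1 ++ y :: ls2) ->
  linked r L1 w y (s1 ++ ls1) -> linked r L2 y z (s2 ++ ls2) ->
  linked r (L1 + L2) w z ((s1 ++ s2) ++ ls1 ++ y :: ls2).
Proof.
move=> u l1 l2; have u' : uniq ((y :: s1 ++ ls1) ++ (z :: s2 ++ ls2)).
  rewrite -(perm_uniq (s1 := (s1 ++ s2) ++ z :: ls1 ++ y :: ls2)) //.
  by apply/permP => f; rewrite !count_cat /= !count_cat /=; lia.
apply: linked_sub (linked_cat u' l1 l2) => v.
by rewrite !(mem_cat, inE) => /orP[/orP[]->|/or3P[]->]; rewrite ?orbT.
Qed.

Definition has_cycle r L S := has (fun x => linked r L x x S) S.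

Lemma has_cycle_sub r L S1 S2 : {subset S1 <= S2} ->
  has_cycle r L S1 -> has_cycle r L S2.
Proof.
move=> sub /hasP[x /sub xS lx]; apply/hasP; exists x => //.
exact: linked_sub lx.
Qed.

Section Step.

Variable r : T -> T -> T -> bool.
Hypothesis r_sym : symmetric3 r.

Local Notation linkedB := (linked (colour r false)).

(** The labels are the joints between the blue pieces, one piece for every two red edges of [t]. An
    inner label must be regular for the pair before it and for the pair after it. *)
Fixpoint regular_labels x t w ls :=
  if ls is w' :: ls' then
    [&& regular r x t w, regular r x t w' &
        regular_labels (last x (take 4 t)) (drop 4 t) w' ls']
  else true.

(** A greedy choice. Each label has to avoid the exception [f] of the preceding pair and the
    exception [g] of the following one, so [j + 2] candidates suffice for [j + 1] labels; [W0] holds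
    the candidates not yet taken. *)
Lemma regular_labels_exist j x t tT W W0 f : size t = 4 * j ->
  stretch r x (t ++ tT) W -> uniq W0 -> {subset W0 <= W} -> j.+2 <= size W0 ->
  exists w ls, [/\ size ls = j, uniq (w :: ls), {subset w :: ls <= W0}, w != f &
                   regular_labels x t w ls].
Proof.
elim: j x t W0 f => [|j IH] x t W0 f szt str uW sub szW.
  case: W0 uW sub szW => [|w [|w' W0]] //=.
  rewrite inE negb_or => /andP[/andP[ww' _] _] _ _.
  have [wf|wf] := eqVneq w f.
    exists w', [::]; split=> //; last by rewrite -wf eq_sym.
    by move=> u; rewrite !inE => /eqP->; rewrite eqxx orbT.
  by exists w, [::]; split=> // u; rewrite !inE => /eqP->; rewrite eqxx.
have szt4 : size (take 4 t) = 4 by rewrite size_takel // szt mulnS.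
have [g gP] : exists g, {in W, forall w, w != g -> regular r x t w}.
  have [|g gP] := @one_irregular _ r r_sym x (t ++ tT) W _ str.
    by rewrite size_cat szt mulnS.
  exists g => w wW wg; have := gP w wW wg.
  by rewrite /regular !nth_cat szt mulnS.
(* At least three candidates are left, and only two are forbidden. *)
have [w wW0 /andP[wf wg]] : exists2 w, w \in W0 & (w != f) && (w != g).
  apply/hasP; rewrite -[has _ _]negbK -all_predC; apply/negP => /allP all_fg.
  suff: size W0 <= size [:: f; g] by move: szW => /=; lia.
  apply: uniq_leq_size => // u /all_fg /=; rewrite negb_and !negbK !inE.
  by case/orP=> ->; rewrite ?orbT.
have [|||||w' [ls [szls uls subls w'g rls]]] :=
    IH (last x (take 4 t)) (drop 4 t) (rem w W0) g.
- by rewrite size_drop szt mulnS addKn.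
- by apply: stretch_catr; rewrite ?szt4 // catA cat_take_drop.
- exact: rem_uniq.
- by move=> u /mem_rem/sub.
- by rewrite size_rem //; case: (size W0) szW.
exists w, (w' :: ls); split=> //=.
- by rewrite szls.
- move: (uls) => /= ->; rewrite andbT; apply/negP => /subls.
  by rewrite mem_rem_uniq // inE eqxx.
- by move=> u; rewrite inE => /predU1P[->//|/subls/mem_rem].
- have w'W : w' \in W by apply/sub/(@mem_rem _ w)/subls; rewrite inE eqxx.
  by rewrite (gP w (sub _ wW0) wg) (gP w' w'W w'g) rls.
Qed.

(** Unites the closing lemmas for both values of [k]. The case [w1 = w3] is left open on purpose: it
    is the one that closes up the blue cycle. *)
Lemma pair_closing k x t w1 w2 w3 c d W : (k == 2) || (k == 3) ->
  size t = 4 + 2 * k -> stretch r x t W -> uniq [:: w2; w3; c; d] ->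
  w1 \notin [:: w2; c; d] -> all [in W] [:: w1; w2; w3; c; d] ->
  regular r x t w1 -> regular r x t w2 ->
  linkedB 2 w1 w2 (belast x (take 4 t)) ||
  linkedB (k + 3) w1 w3 (belast x t ++ [:: w2; c; d]).
Proof.
move=> k23 szt str u w1N sub n1 n2.
have [w13|w13] := eqVneq w1 w3.
  have u' : uniq [:: w1; w2; c; d].
    by move: u w1N; rewrite /= !inE !negb_or => /and4P[/and3P[_ -> ->] _ -> _] ->.
  have sub' : all [in W] [:: w1; w2; c; d].
    by move: sub => /= /and5P[-> -> _ -> ->].
  case/orP: k23 => /eqP k_eq; rewrite k_eq -w13 in szt *.
    exact: pair_closing2_cycle str u' sub' n1 n2.
  exact: pair_closing3_cycle str u' sub' n1 n2.
have u' : uniq [:: w1; w2; w3; c; d].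
  rewrite cons_uniq u andbT; move: w1N; rewrite !inE !negb_or w13.
  by case/and3P=> -> -> ->.
case/orP: k23 => /eqP k_eq; rewrite k_eq in szt *.
  exact: pair_closing2 str u' sub n1 n2.
exact: pair_closing3 str u' sub n1 n2.
Qed.

Lemma size4P t n : size t = 4 * n.+1 ->
  exists v1 v2 v3 v4 t', t = [:: v1, v2, v3, v4 & t'] /\ size t' = 4 * n.
Proof.
rewrite mulnS; case: t => [|v1 [|v2 [|v3 [|v4 t]]]] //= [szt].
by exists v1, v2, v3, v4, t.
Qed.

(** By induction on the labels. A pair contributes two blue edges by itself, or four together with
    the next pair, or [k + 3] together with the closing edges [tT]. The ends [w] and [b] may
    coincide as long as a label lies between them, since [closes] speaks of distinct ends only. *)
Lemma chain k tT W b c d ls x t w : (k == 2) || (k == 3) -> size tT = 2 * k ->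
  size t = 4 * size ls -> stretch r x (t ++ tT) W ->
  uniq (b :: ls ++ [:: c; d]) -> all [in W] (b :: ls ++ [:: c; d]) -> w \in W ->
  w \notin ls ++ [:: c; d] -> (ls == [::]) ==> (w != b) ->
  regular_labels x t w ls -> closes r k (last x t) tT W ->
  linkedB (2 * size ls + k.+1) w b (belast x (t ++ tT) ++ ls ++ [:: c; d]).
Proof.
move=> k23 sztT; have [n] := ubnP (size ls).
elim: n ls x t w => // n IH [|w1 ls] x t w szn szt str uls subls wW wN wb reg cl.
  have {szt}t0 : t = [::] by case: t szt {str reg cl}.
  rewrite {t str reg}t0 in cl *.
  rewrite [size _]/= muln0 add0n; apply: (closesP cl).
    by rewrite cons_uniq [uniq _]uls andbT inE negb_or (implyP wb).
  by move: subls => /= ->; rewrite wW.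
have [v1 [v2 [v3 [v4 [t' [tE {}szt]]]]]] := size4P szt.
rewrite {t}tE in str reg cl *; move: t' => t in szt str reg cl *.
move: reg; rewrite [regular_labels _ _ _ _]/= drop0 take0 => /and3P[reg1 reg2 reg].
have {}reg1 : ~~ (r x v1 w && r v1 v2 w) := reg1.
have {}reg2 : ~~ (r x v1 w1 && r v1 v2 w1) := reg2.
have [u2 uL] : uniq (belast x ([:: v1, v2, v3, v4 & t] ++ tT) ++ W) /\
   uniq (belast x ([:: v1, v2, v3, v4 & t] ++ tT) ++ (b :: w1 :: ls ++ [:: c; d])).
  case: str => _ u2 _ _; split=> //; move: u2; rewrite !cat_uniq => /and3P[-> dis _].
  rewrite uls andbT andTb; apply: contra dis => /hasP[z zin zb]; apply/hasP.
  by exists z => //; apply: (allP subls).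
have w1N : w1 \notin ls ++ [:: c; d] by case/and3P: uls.
have w1b : w1 != b by move: uls; rewrite /= inE negb_or eq_sym => /andP[/andP[]].
have w1W : w1 \in W by case/and3P: subls.
(* If this pair succeeds by itself, the chain continues from the label [w1]. *)
have [A|notA] := boolP (linkedB 2 w w1 [:: x; v1; v2; v3]).
  have str' : stretch r v4 (t ++ tT) W.
    exact: (@stretch_catr _ r x [:: v1; v2; v3; v4] (t ++ tT) W isT str).
  have B : linkedB (2 * size ls + k.+1) w1 b (belast v4 (t ++ tT) ++ ls ++ [:: c; d]).
    apply: IH => //.
    - case/and3P: uls => bN _ uls'; apply/andP; split=> //.
      by apply: contra bN; rewrite inE orbC => ->.
    - by case/and3P: subls => bW _ sW; apply/andP.
    - by rewrite w1b implybT.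
  have lenE : 2 + (2 * size ls + k.+1) = 2 * (size ls).+1 + k.+1 by clear; lia.
  by rewrite -lenE; apply: (@linked_glue _ _ _ w w1 b [:: x; v1; v2; v3] _ [::]).
(* Otherwise the pair is merged with the closing edges if it is the last one, and with the next pair
   if not; then [w1] becomes an inner vertex of the longer piece. *)
case: ls => [|w2 ls] in szn szt uls subls wN reg w1N IH uL wb *.
  have {szt} t0 : t = [::] by case: t szt {str reg cl u2 uL}.
  rewrite {t}t0 in str uL u2 reg cl *.
  have u' : uniq [:: w1; b; c; d].
    move: uls; rewrite /= !inE !negb_or => /and4P[/and3P[bw1 -> ->] /andP[-> ->] -> _].
    by rewrite eq_sym bw1.
  have sub' : all [in W] [:: w; w1; b; c; d].
    by move: subls => /= /and5P[-> -> -> -> _]; rewrite wW.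
  have szT : size ([:: v1; v2; v3; v4] ++ tT) = 4 + 2 * k by rewrite size_cat sztT.
  have lenE : k + 3 = 2 * 1 + k.+1 by clear; lia.
  have /orP[A|] := pair_closing k23 szT str u' wN sub' reg1 reg2.
    by rewrite /= take0 in A; rewrite A in notA.
  by rewrite lenE.
have [v5 [v6 [v7 [v8 [t' [tE {}szt]]]]]] := size4P szt.
rewrite {t}tE in str reg cl u2 uL *; move: t' => t in szt str reg cl u2 uL *.
move: reg; rewrite [regular_labels _ _ _ _]/= drop0 take0 => /and3P[_ _ reg].
have w2N : w2 \notin ls ++ [:: c; d] by case/and4P: uls.
have w2b : w2 != b.
  by move: uls; rewrite /= !inE !negb_or => /andP[/and3P[_]]; rewrite eq_sym.
have w2W : w2 \in W by case/and4P: subls.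
have str8 : stretch r x [:: v1; v2; v3; v4; v5; v6; v7; v8] W.
  exact: (@stretch_catl _ r x [:: v1; v2; v3; v4; v5; v6; v7; v8] (t ++ tT) W isT str).
have str' : stretch r v8 (t ++ tT) W.
  exact: (@stretch_catr _ r x [:: v1; v2; v3; v4; v5; v6; v7; v8] (t ++ tT) W isT str).
have := @pair_pair _ r r_sym x [:: v1; v2; v3; v4; v5; v6; v7; v8] w w1 w2 W erefl str8.
rewrite /= (negPf notA) /= => A.
have {}A : linkedB 4 w w2 [:: x; v1; v2; v3; v4; v5; v6; v7; w1].
  apply: A => //; last by rewrite wW w1W w2W.
  by move: wN w1N; rewrite /= !inE !negb_or andbT => /and3P[-> -> _] /andP[].
have B : linkedB (2 * size ls + k.+1) w2 b (belast v8 (t ++ tT) ++ ls ++ [:: c; d]).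
  apply: IH => //.
  - by move: szn; rewrite /= !ltnS => /ltnW.
  - case/and4P: uls => bN _ _ uls'; apply/andP; split=> //.
    by apply: contra bN => h; rewrite !inE h !orbT.
  - by case/and4P: subls => bW _ _ sW; apply/andP.
  - by rewrite w2b implybT.
have lenE : 4 + (2 * size ls + k.+1) = 2 * (size ls).+2 + k.+1 by clear; lia.
rewrite -lenE.
exact: (@linked_glue _ _ _ w w2 b [:: x; v1; v2; v3; v4; v5; v6; v7] _ [:: w1]).
Qed.

(** * Red cycles that cannot be lengthened by one edge *)

Definition red_cycle x p S L :=
  [/\ size p = 2 * L, uniq p, last x p = x, {subset p <= S} & lpath r x p].

Lemma red_cycle_rot x p1 p2 S L : ~~ odd (size p1) ->
  red_cycle x (p1 ++ p2) S L -> red_cycle (last x p1) (p2 ++ p1) S L.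
Proof.
move=> ev [szp up lp sub pp].
have ev2 : ~~ odd (size p2) by move: szp ev; rewrite size_cat; lia.
rewrite last_cat in lp; rewrite lpath_cat // in pp; case/andP: pp => pp1 pp2.
split.
- by rewrite size_cat addnC -size_cat.
- by rewrite uniq_catC.
- by rewrite last_cat lp.
- by move=> z; rewrite mem_cat orbC -mem_cat; apply: sub.
- by rewrite lpath_cat // pp2 lp pp1.
Qed.

Lemma belast_closed x p : last x p = x -> perm_eq (belast x p) p.
Proof.
case/lastP: p => // p y; rewrite last_rcons => ->.
by rewrite belast_rcons perm_sym perm_rcons.
Qed.

(** A detour [q] for the edges [t2] would turn the cycle into [t1 ++ q ++ t3], a red cycle with
    [L.+1] edges. *)
Lemma red_cycle_stretch x p S W L : red_cycle x p S L -> 0 < L -> uniq W ->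
  {subset W <= S} -> {in W, forall w, w \notin p} -> ~~ has_cycle r L.+1 S ->
  stretch r x p W.
Proof.
move=> [szp up lp sub pp] L0 uW subW dis ncyc.
have uD s : uniq s -> s =i p -> uniq (s ++ W).
  move=> us sp; rewrite cat_uniq us uW andbT; apply/hasPn => w /dis.
  by rewrite -sp.
have xp : x \in p.
  rewrite -lp; case: p szp {up lp sub pp dis uD} => [|y p] /= => [|_]; first lia.
  exact: mem_last.
split=> //; first exact: uD.
  have pm := belast_closed lp.
  by apply: uD; [rewrite (perm_uniq pm) | exact: perm_mem].
move=> t1 t2 t3 l pE ev l0 sz2; apply: contra ncyc => /linkedP[q [szq uq lq subq pq]].
apply/hasP; exists x; first exact: sub.
have ev2 : ~~ odd (size t2) by rewrite sz2; lia.
(* The end of the detour belongs to [t2], so that all of [q] lies in [t2 ++ W]. *)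
have lt2 : last x (t1 ++ t2) \in t2.
  by rewrite last_cat; case: (t2) sz2 => [|y s] /=; [lia | rewrite mem_last].
have {}subq : {subset q <= t2 ++ W}.
  by move=> z /subq; rewrite inE => /predU1P[->|//]; rewrite mem_cat lt2.
move: pp; rewrite pE lpath_cat // lpath_cat // => /and3P[pp1 pp2 pp3].
apply/linkedP; exists (t1 ++ q ++ t3); split.
- by move: szp; rewrite pE !size_cat szq sz2; lia.
- move: up dis; rewrite pE uniq_catCA cat_uniq => /and3P[u2 d2 u13] dis.
  rewrite uniq_catCA cat_uniq uq u13 andbT; apply/hasPn => z z13.
  apply/negP => /subq; rewrite mem_cat => /orP[z2|/dis].
    by case/hasP: d2; exists z.
  by move: z13; rewrite !mem_cat => /orP[]->; rewrite ?orbT.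
- by rewrite -[RHS]lp pE !last_cat lq last_cat.
- move=> z; rewrite inE !mem_cat => h; apply/orP; right; move: h.
  case/or3P=> [h|/subq|h]; first by apply: sub; rewrite pE mem_cat h.
    by rewrite mem_cat => /orP[h|/subW//]; apply: sub; rewrite pE !mem_cat h orbT.
  by apply: sub; rewrite pE !mem_cat h !orbT.
- rewrite lpath_cat // pp1 lpath_cat ?szq; last by lia.
  by rewrite pq lq last_cat.
Qed.

Lemma closes_shift k x t W : (k == 2) || (k == 3) -> size t = 2 * k.+1 ->
  stretch r x t W ->
  closes r k x (take (2 * k) t) W || closes r k (last x (take 2 t)) (drop 2 t) W.
Proof.
by case/orP=> /eqP-> sz str; [apply: closes2_shift | apply: closes3_shift].
Qed.

(** If the first [k] edges do not close, the [k] edges from the second one on do, and the cycle is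
    rotated by one edge, that is, by two vertices. *)
Lemma red_cycle_closes k x p S W L : (k == 2) || (k == 3) -> k < L ->
  red_cycle x p S L -> uniq W -> {subset W <= S} ->
  {in W, forall w, w \notin p} -> ~~ has_cycle r L.+1 S ->
  exists y q, [/\ red_cycle y q S L, q =i p & closes r k y (take (2 * k) q) W].
Proof.
move=> k23 kL rc uW subW dis ncyc; have [szp _ _ _ _] := rc.
have L0 : 0 < L by lia.
have str := red_cycle_stretch rc L0 uW subW dis ncyc.
have sz2k : size (take (2 * k.+1) p) = 2 * k.+1 by rewrite size_takel // szp; lia.
have evk : ~~ odd (2 * k.+1) by lia.
have := @closes_shift k x (take (2 * k.+1) p) W k23 sz2k.
rewrite -{1}[p](cat_take_drop (2 * k.+1)) in str.
have {}str := stretch_catl _ str; rewrite sz2k in str.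
case/(_ (str evk))/orP => cl.
  by exists x, p; rewrite take_takel in cl; last by lia.
rewrite take_takel in cl; last by lia.
exists (last x (take 2 p)), (drop 2 p ++ take 2 p); split.
- apply: red_cycle_rot; last by rewrite cat_take_drop.
  by rewrite size_takel // szp; lia.
- by move=> z; rewrite mem_cat orbC -mem_cat cat_take_drop.
- rewrite takel_cat; last by rewrite size_drop szp; lia.
  by rewrite take_drop addnC -mulnS.
Qed.

End Step.

End LooseCycles.

(** * The upper bound *)

Section RamseyUpperBound.

Variable T : finType.
Implicit Types (x y z w a b c d : T) (s t p ls S W : seq T).
Implicit Type r : T -> T -> T -> bool.

Definition off p S := [seq w <- S | w \notin p].

Lemma size_off p S n : uniq S -> size p + n <= size S -> n <= size (off p S).
Proof.
move=> uS; rewrite -(count_predC [in p] S) -!size_filter.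
have : size [seq u <- S | u \in p] <= size p.
  by apply: uniq_leq_size => [|u]; rewrite ?filter_uniq // mem_filter => /andP[].
rewrite -[[seq u <- S | predC _ u]]/(off p S) => le1 le2.
by rewrite -(leq_add2l (size p)) (leq_trans le2) ?leq_add2r.
Qed.

Lemma off_sub p S : {subset off p S <= S}.
Proof. by move=> u; rewrite mem_filter => /andP[]. Qed.

Lemma off_notin p S : {in off p S, forall w, w \notin p}.
Proof. by move=> u; rewrite mem_filter => /andP[]. Qed.

Lemma cycle_of_has r L S : has_cycle r L S -> exists x p, red_cycle r x p S L.
Proof.
case/hasP=> x xS /linkedP[p [sz up lp sub pp]].
by exists x, p; split=> // u /sub; rewrite inE => /predU1P[->|].
Qed.

Lemma cycle_start r x p S L : 0 < L -> red_cycle r x p S L -> x \in p.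
Proof.
move=> L0 [sz _ lp _ _]; rewrite -lp.
by case: p sz {lp} => [|y p] /= sz; [lia | rewrite mem_last].
Qed.

Lemma stretch_sub r x p1 p2 S L : 0 < L -> red_cycle r x (p1 ++ p2) S L ->
  {subset belast x p1 <= S}.
Proof.
move=> L0 rc u /mem_belast; have xp := cycle_start L0 rc; case: rc => _ _ _ sub _.
rewrite inE => /predU1P[->|up]; apply: sub => //.
by rewrite mem_cat up.
Qed.

Section Step.

Variable r : T -> T -> T -> bool.
Hypothesis r_sym : symmetric3 r.

Local Notation blue_cycle := (has_cycle (colour r false)).

(** The chain runs over [2 * j] red edges and then over [k] closing ones, and returns to its first
    label. Of the [j + 3] vertices off the red cycle, [j + 1] become labels and two become the
    helpers [c] and [d]. *)
Lemma long_cycle_step k j x p S L : (k == 2) || (k == 3) -> 0 < j ->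
  2 * j + k <= L -> red_cycle r x p S L -> uniq S -> 2 * L + (j + 3) <= size S ->
  ~~ has_cycle r L.+1 S -> blue_cycle (2 * j + k.+1) S.
Proof.
move=> k23 j0 jL rc uS szS ncyc.
have L0 : 0 < L by lia.
have kL : k < L by lia.
have szp : size p = 2 * L by case: rc.
pose W := off p S; have uW : uniq W by apply: filter_uniq.
have szW : j + 3 <= size W by apply: size_off => //; rewrite szp.
have [y [q [rcq qp cl]]] :=
  red_cycle_closes r_sym k23 kL rc uW (@off_sub _ _) (@off_notin _ _) ncyc.
(* The closing edges are the first ones of [q]; the [2 * j] edges of the chain are the last ones, so
   that they lead up to the vertex [y]. *)
pose l := 2 * L - 4 * j; pose q1 := take l q; pose q2 := drop l q.
have szq : size q = 2 * L by case: rcq.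
have szq1 : size q1 = l by rewrite size_takel // szq /l; lia.
have szq2 : size q2 = 4 * j by rewrite size_drop szq /l; lia.
have ly : last (last y q1) q2 = y.
  by rewrite -last_cat cat_take_drop; case: rcq.
pose tT := take (2 * k) q; have szT : size tT = 2 * k by rewrite size_takel // szq; lia.
have q1E : q1 = tT ++ drop (2 * k) q1.
  by rewrite -[LHS](cat_take_drop (2 * k)) take_takel // /l; lia.
(* Rotation makes the edges of the chain and the closing edges a prefix of the cycle. *)
have {rcq} : red_cycle r (last y q1) ((q2 ++ tT) ++ drop (2 * k) q1) S L.
  rewrite -catA -q1E; apply: red_cycle_rot; last by rewrite cat_take_drop.
  by rewrite szq1 /l; lia.
move: (last y q1) ly => x' ly rc'.
have disq : {in W, forall w, w \notin (q2 ++ tT) ++ drop (2 * k) q1}.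
  move=> w /off_notin; rewrite -catA -q1E mem_cat orbC -mem_cat cat_take_drop.
  by rewrite qp.
have str : stretch r x' (q2 ++ tT) W.
  apply: stretch_catl (red_cycle_stretch rc' L0 uW (@off_sub _ _) disq ncyc).
  by rewrite size_cat szq2 szT; lia.
have [|w [ls [szls uls subls _ reg]]] :=
    regular_labels_exist r_sym x' szq2 str uW (fun u uW => uW).
  by apply: leq_trans szW; rewrite addn3.
have szs : 2 <= size (off (w :: ls) W).
  by apply: size_off => //; apply: leq_trans szW; rewrite /= szls addSn addn2 addn3.
have us : uniq (off (w :: ls) W) by apply: filter_uniq.
have := @off_notin (w :: ls) W; have := @off_sub (w :: ls) W.
case: (off _ _) szs us => [|c [|d s]] //= _ /andP[]; rewrite inE negb_or.
move=> /andP[cd _] _ subs dis.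
have cW : c \in W by apply: subs; rewrite inE eqxx.
have dW : d \in W by apply: subs; rewrite !inE eqxx orbT.
have : c \notin w :: ls by apply: dis; rewrite inE eqxx.
have : d \notin w :: ls by apply: dis; rewrite !inE eqxx orbT.
rewrite !inE !negb_or => /andP[dw dls] /andP[cw cls].
have wW : w \in W by apply: subls; rewrite inE eqxx.
have wN : w \notin ls ++ [:: c; d].
  move: uls => /andP[wls _]; rewrite mem_cat !inE !negb_or wls.
  by rewrite [w == c]eq_sym [w == d]eq_sym cw dw.
have uls' : uniq (w :: ls ++ [:: c; d]).
  have uls1 : uniq ls by case/andP: uls.
  by rewrite cons_uniq wN cat_uniq uls1 /= inE cd orbF negb_or cls dls.
have suball : all [in W] (w :: ls ++ [:: c; d]).
  apply/allP => u; rewrite -cat_cons mem_cat !inE => /orP[/subls//|].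
  by case/orP=> /eqP->.
(* The chain is applied with [b := w]; as [j] is positive, there is a label in between. *)
have nls : (ls == [::]) ==> (w != w) by rewrite -size_eq0 szls eqn0Ngt j0.
rewrite -ly in cl.
have szq2' : size q2 = 4 * size ls by rewrite szls.
have := chain r_sym k23 szT szq2' str uls' suball wW wN nls reg cl.
rewrite szls => lk; apply/hasP; exists w; first exact: off_sub wW.
apply: linked_sub lk => u; rewrite mem_cat => /orP[|uls2].
  exact: stretch_sub L0 rc' u.
by apply: (@off_sub p); apply: (allP suball); rewrite inE uls2 orbT.
Qed.

Lemma three_off x p S L : red_cycle r x p S L -> uniq S -> 2 * L + 3 <= size S ->
  exists a b c, uniq [:: a; b; c] /\ all [in off p S] [:: a; b; c].
Proof.
move=> [szp _ _ _ _] uS szS.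
have : 3 <= size (off p S) by apply: size_off; rewrite // szp.
have : uniq (off p S) by apply: filter_uniq.
case: (off p S) => [|a [|b [|c s]]] // u _; exists a, b, c; split.
  by move: u; rewrite /= !inE !negb_or => /and4P[/and3P[-> -> _] /andP[-> _] _ _].
by rewrite /= !inE !eqxx !orbT.
Qed.

Lemma cycle_prefix_stretch x p S L n : 0 < L -> red_cycle r x p S L -> uniq S ->
  ~~ has_cycle r L.+1 S -> ~~ odd n -> n <= 2 * L ->
  [/\ size (take n p) = n, stretch r x (take n p) (off p S) &
      {subset belast x (take n p) <= S}].
Proof.
move=> L0 rc uS ncyc ev nL; have szp : size p = 2 * L by case: rc.
have szt : size (take n p) = n by rewrite size_takel // szp.
have uW : uniq (off p S) by apply: filter_uniq.
split=> //; last by apply: (@stretch_sub r x _ (drop n p) S L); rewrite ?cat_take_drop.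
have := red_cycle_stretch rc L0 uW (@off_sub _ _) (@off_notin _ _) ncyc.
by rewrite -{1}[p](cat_take_drop n) => /stretch_catl; apply; rewrite szt.
Qed.

Lemma triangle_step x p S L : 3 <= L -> red_cycle r x p S L -> uniq S ->
  2 * L + 3 <= size S -> ~~ has_cycle r L.+1 S -> blue_cycle 3 S.
Proof.
move=> L3 rc uS szS ncyc.
have [a [b [c [u sub]]]] := three_off rc uS szS.
have L0 : 0 < L by lia.
have L6 : 6 <= 2 * L by lia.
have [szt str subS] := cycle_prefix_stretch (n := 6) L0 rc uS ncyc isT L6.
have close u1 u2 u3 : all [in off p S] [:: u1; u2; u3] ->
    linked (colour r false) 3 u1 u1 (belast x (take 6 p) ++ [:: u2; u3]) ->
    blue_cycle 3 S.
  case/and4P=> /off_sub u1S /off_sub u2S /off_sub u3S _ lk; apply/hasP; exists u1 => //.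
  apply: linked_sub lk => v; rewrite mem_cat !inE => /or3P[/subS//|/eqP->//|/eqP->//].
case/and4P: (sub) => aW bW cW _.
case/or3P: (blue_triangle r_sym szt str u sub); apply: close => //=; exact/and4P.
Qed.

Lemma quadrangle_step x p S L : 4 <= L -> red_cycle r x p S L -> uniq S ->
  2 * L + 3 <= size S -> ~~ has_cycle r L.+1 S -> blue_cycle 4 S.
Proof.
move=> L4 rc uS szS ncyc.
have [a [b [c [u sub]]]] := three_off rc uS szS.
have L0 : 0 < L by lia.
have L8 : 8 <= 2 * L by lia.
have [szt str subS] := cycle_prefix_stretch (n := 8) L0 rc uS ncyc isT L8.
have close u1 u2 u3 : all [in off p S] [:: u1; u2; u3] ->
    linked (colour r false) 4 u1 u1 (belast x (take 8 p) ++ [:: u2; u3]) ->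
    blue_cycle 4 S.
  case/and4P=> /off_sub u1S /off_sub u2S /off_sub u3S _ lk; apply/hasP; exists u1 => //.
  apply: linked_sub lk => v; rewrite mem_cat !inE => /or3P[/subS//|/eqP->//|/eqP->//].
case/and4P: (sub) => aW bW cW _.
case/or3P: (blue_quadrangle r_sym szt str u sub); apply: close => //=; exact/and4P.
Qed.

(** * Small cases on seven and nine vertices *)

Definition cycle_goals (k : bool) (L n : nat) : seq goal :=
  [seq (k, L, i, i, iota 0 n) | i <- iota 0 n].

Lemma cycle_goals_sound k L x s S : {subset x :: s <= S} ->
  has (realized r x s) (cycle_goals k L (size s).+1) ->
  has_cycle (colour r k) L S.
Proof.
move=> sub /hasP[_ /mapP[i iin ->]] lk.
have {}lk : linked (colour r k) L (nth x (x :: s) i) (nth x (x :: s) i)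
  (map (nth x (x :: s)) (iota 0 (size s).+1)) by [].
apply: has_cycle_sub sub _; apply/hasP; exists (nth x (x :: s) i).
  by rewrite mem_nth //; move: iin; rewrite mem_iota.
apply: linked_sub lk => u /mapP[j jin ->].
by rewrite mem_nth //; move: jin; rewrite mem_iota.
Qed.

(** The start of the induction, [n = m = 3], where the certificate assumes nothing about the 35
    triples. *)
Lemma seven_vertices S : uniq S -> 7 <= size S ->
  has_cycle r 3 S || blue_cycle 3 S.
Proof.
move=> uS szS.
have : size (take 7 S) = 7 by rewrite size_takel.
have : uniq (take 7 S) by apply: take_uniq.
have : {subset take 7 S <= S} by move=> u /mem_take.
case: (take 7 S) => [|x s] // sub uxs [szs].
have : has (realized r x s) (cycle_goals true 3 7 ++ cycle_goals false 3 7).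
  (* The value [7] is out of range: all seven vertices are distinct, and no coincidence has to be
     allowed for. *)
  apply: (check_sound (e := 7) (H := [::])
    (reds := [:: [:: 2; 4; 5; 6; 3; 1; 2]; [:: 3; 0; 4; 6; 5; 2; 3];
      [:: 0; 4; 3; 1; 2; 6; 0]; [:: 0; 3; 4; 5; 2; 6; 0];
      [:: 0; 2; 6; 1; 4; 3; 0]; [:: 0; 6; 3; 1; 2; 5; 0];
      [:: 0; 1; 5; 4; 2; 6; 0]; [:: 0; 1; 5; 4; 6; 2; 0];
      [:: 0; 5; 1; 6; 3; 4; 0]; [:: 0; 5; 1; 2; 4; 3; 0];
      [:: 0; 5; 1; 3; 2; 4; 0]; [:: 0; 1; 5; 3; 6; 4; 0];
      [:: 0; 2; 3; 6; 1; 5; 0]; [:: 0; 2; 6; 4; 1; 5; 0]])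
    (blues := [:: [:: 0; 1; 5; 4; 6; 2; 0]; [:: 0; 1; 5; 3; 2; 6; 0];
      [:: 0; 4; 3; 1; 2; 6; 0]; [:: 0; 4; 3; 1; 6; 2; 0];
      [:: 0; 4; 3; 2; 1; 5; 0]; [:: 0; 4; 3; 6; 5; 1; 0];
      [:: 0; 1; 5; 2; 4; 3; 0]; [:: 0; 6; 4; 5; 2; 3; 0];
      [:: 0; 2; 5; 6; 4; 3; 0]; [:: 1; 3; 2; 5; 4; 6; 1];
      [:: 1; 3; 6; 0; 2; 4; 1]; [:: 0; 2; 4; 5; 6; 3; 0];
      [:: 0; 2; 6; 5; 3; 4; 0]])
    (ds := [:: (0, 3, 4); (0, 2, 6); (0, 1, 5); (0, 1, 5); (0, 2, 6)])) => //;
    last by rewrite szs; vm_compute.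
  - by case/andP: uxs.
  - by rewrite take_oversize ?drop_oversize ?cats0 //= szs.
have sz7 : 7 = (size s).+1 by rewrite szs.
by rewrite has_cat sz7 => /orP[]/(cycle_goals_sound sub)->; rewrite ?orbT.
Qed.

(** Needed for [n = m = 4]: the red cycle then has only three edges, too few for [quadrangle_step],
    so the certificate concerns all nine vertices and both colours. *)
Lemma nine_vertices x p S : red_cycle r x p S 3 -> uniq S -> 9 <= size S ->
  ~~ has_cycle r 4 S -> blue_cycle 4 S.
Proof.
move=> rc uS szS ncyc.
have [a [b [c [u sub]]]] := three_off rc uS szS.
have [szp up lp subp pp] := rc.
case: p szp up lp subp pp sub rc => [|v1 [|v2 [|v3 [|v4 [|v5 [|v6 [|]]]]]]] // _.
(* The last entry [v6] is [x] itself; the six vertices of the cycle are [x] and [v1] to [v5]. *)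
move=> up lp subp; rewrite [last _ _]/= in lp; rewrite {v6}lp in up subp *.
rewrite [lpath _ _ _]/= !andbT => /and3P[p1 p2 p3] sub rc.
pose s := [:: v1; v2; v3; v4; v5; a; b; c].
have pm : perm_eq (x :: s) ([:: v1; v2; v3; v4; v5; x] ++ [:: a; b; c]).
  by rewrite -[x :: s]/([:: x] ++ [:: v1; v2; v3; v4; v5] ++ [:: a; b; c]) perm_catCA.
have ux : uniq (x :: s).
  have : uniq ([:: v1; v2; v3; v4; v5; x] ++ [:: a; b; c]).
    rewrite cat_uniq up u andbT andTb; apply/hasPn => v vin.
    by have /off_notin := allP sub _ vin.
  by rewrite (perm_uniq pm).
have subs : {subset x :: s <= S}.
  move=> v; rewrite (perm_mem pm) mem_cat => /orP[/subp//|vin].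
  exact: (@off_sub _ S _ (allP sub _ vin)).
have : has (realized r x s) (cycle_goals true 4 9 ++ cycle_goals false 4 9).
  apply: (check_sound (e := 9)
    (H := [:: [:: (true, (0, 1, 2))]; [:: (true, (2, 3, 4))];
      [:: (true, (0, 4, 5))]])
    (reds := [:: [:: 0; 2; 1; 8; 7; 6; 4; 5; 0];
      [:: 0; 1; 2; 3; 7; 8; 4; 5; 0]; [:: 0; 1; 2; 8; 7; 6; 4; 5; 0];
      [:: 2; 7; 3; 1; 4; 0; 5; 6; 2]; [:: 0; 1; 2; 8; 7; 3; 5; 4; 0];
      [:: 0; 1; 2; 3; 7; 6; 5; 4; 0]; [:: 0; 2; 1; 3; 8; 6; 4; 5; 0];
      [:: 0; 2; 1; 3; 8; 7; 4; 5; 0]; [:: 0; 1; 2; 6; 7; 8; 4; 5; 0];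
      [:: 0; 2; 1; 6; 8; 7; 4; 5; 0]; [:: 0; 2; 1; 3; 7; 8; 4; 5; 0];
      [:: 1; 7; 3; 2; 4; 0; 5; 8; 1]; [:: 1; 7; 3; 2; 4; 0; 5; 6; 1];
      [:: 1; 7; 2; 3; 4; 0; 5; 8; 1]; [:: 1; 7; 2; 3; 4; 0; 5; 6; 1];
      [:: 0; 2; 1; 6; 4; 7; 8; 3; 0]; [:: 0; 5; 4; 3; 2; 7; 8; 6; 0];
      [:: 0; 6; 8; 7; 4; 3; 2; 1; 0]; [:: 0; 8; 3; 4; 2; 1; 6; 5; 0];
      [:: 0; 2; 7; 8; 4; 3; 6; 5; 0]; [:: 0; 2; 1; 3; 6; 8; 5; 4; 0];
      [:: 0; 2; 1; 3; 6; 4; 5; 8; 0]; [:: 0; 8; 7; 1; 3; 2; 4; 5; 0];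
      [:: 0; 8; 7; 1; 2; 3; 4; 5; 0]; [:: 0; 5; 4; 3; 2; 1; 7; 6; 0];
      [:: 0; 1; 2; 3; 4; 6; 8; 5; 0]; [:: 0; 1; 2; 3; 4; 8; 6; 7; 0];
      [:: 0; 1; 2; 3; 4; 8; 5; 7; 0]; [:: 0; 1; 2; 3; 4; 5; 8; 6; 0];
      [:: 0; 1; 2; 3; 6; 8; 4; 5; 0]; [:: 0; 4; 6; 1; 7; 3; 2; 8; 0];
      [:: 0; 1; 6; 7; 2; 3; 4; 5; 0]; [:: 0; 5; 6; 7; 4; 3; 2; 1; 0];
      [:: 0; 5; 6; 1; 4; 2; 3; 7; 0]; [:: 0; 1; 4; 2; 3; 6; 5; 7; 0];
      [:: 0; 3; 7; 6; 1; 5; 4; 8; 0]; [:: 0; 1; 6; 8; 3; 2; 4; 5; 0];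
      [:: 0; 5; 2; 6; 1; 3; 7; 4; 0]; [:: 0; 5; 2; 6; 1; 7; 3; 4; 0];
      [:: 0; 5; 2; 3; 4; 6; 1; 8; 0]; [:: 0; 5; 2; 3; 4; 1; 6; 8; 0];
      [:: 0; 5; 2; 3; 1; 6; 4; 7; 0]; [:: 0; 5; 2; 3; 1; 6; 4; 8; 0];
      [:: 0; 5; 2; 3; 1; 6; 8; 4; 0]; [:: 0; 7; 6; 1; 4; 2; 3; 8; 0];
      [:: 0; 7; 6; 1; 4; 2; 3; 5; 0]; [:: 0; 6; 7; 1; 3; 2; 4; 5; 0];
      [:: 0; 5; 4; 2; 3; 8; 1; 6; 0]; [:: 0; 7; 2; 4; 3; 6; 1; 5; 0];
      [:: 0; 5; 7; 8; 2; 4; 3; 1; 0]; [:: 0; 5; 7; 8; 4; 3; 2; 1; 0]])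
    (blues := [:: [:: 0; 5; 3; 1; 4; 7; 8; 6; 0];
      [:: 0; 4; 8; 3; 1; 5; 6; 7; 0]; [:: 0; 4; 8; 3; 1; 7; 2; 5; 0];
      [:: 0; 3; 8; 1; 6; 2; 7; 5; 0]; [:: 0; 3; 8; 1; 6; 2; 7; 4; 0];
      [:: 0; 8; 6; 4; 7; 3; 5; 1; 0]; [:: 0; 8; 6; 4; 7; 2; 3; 5; 0];
      [:: 0; 8; 6; 4; 7; 5; 3; 1; 0]; [:: 0; 8; 6; 4; 3; 2; 7; 5; 0];
      [:: 0; 3; 5; 2; 6; 7; 1; 8; 0]; [:: 0; 1; 6; 4; 5; 3; 7; 2; 0];
      [:: 0; 1; 6; 5; 8; 7; 4; 3; 0]; [:: 1; 3; 7; 2; 8; 4; 6; 0; 1];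
      [:: 1; 3; 7; 2; 8; 4; 6; 5; 1]; [:: 1; 3; 7; 2; 8; 5; 4; 6; 1];
      [:: 1; 3; 7; 2; 8; 6; 4; 0; 1]; [:: 1; 3; 7; 2; 8; 6; 4; 5; 1];
      [:: 0; 6; 4; 8; 7; 1; 3; 5; 0]; [:: 0; 3; 5; 7; 6; 4; 8; 2; 0];
      [:: 0; 5; 7; 2; 1; 3; 8; 6; 0]; [:: 0; 5; 7; 2; 1; 3; 6; 8; 0];
      [:: 0; 6; 1; 2; 7; 3; 5; 8; 0]; [:: 0; 2; 5; 1; 8; 4; 7; 6; 0];
      [:: 1; 5; 8; 4; 6; 7; 2; 3; 1]; [:: 1; 5; 8; 4; 7; 0; 6; 3; 1];
      [:: 1; 5; 8; 4; 7; 0; 6; 2; 1]; [:: 0; 7; 3; 1; 8; 4; 5; 2; 0];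
      [:: 0; 2; 5; 4; 8; 3; 6; 7; 0]; [:: 0; 5; 8; 1; 3; 2; 6; 7; 0];
      [:: 0; 7; 8; 3; 1; 4; 6; 5; 0]; [:: 0; 5; 6; 1; 7; 4; 8; 3; 0];
      [:: 0; 5; 6; 2; 7; 1; 8; 3; 0]; [:: 0; 2; 7; 3; 1; 5; 6; 8; 0];
      [:: 0; 7; 6; 5; 3; 2; 1; 8; 0]; [:: 0; 6; 8; 3; 1; 2; 7; 4; 0]])
    (ds := [:: (4, 6, 8); (1, 3, 7); (1, 5, 6); (2, 7, 8); (0, 6, 8);
      (0, 2, 5); (4, 6, 7)]));
    [exact: r_sym | by case/andP: ux | exact: ux | | by vm_compute].
  by have [r12 r23] := r_sym; rewrite /satisfies /valuation /= !orbF p1 p2 r12 r23 p3.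
rewrite has_cat => /orP[/(cycle_goals_sound subs)|/(cycle_goals_sound subs)//].
by rewrite /= (negPf ncyc).
Qed.

End Step.

Lemma eq_has_cycle r1 r2 L S : (forall x y z, r1 x y z = r2 x y z) ->
  has_cycle r1 L S = has_cycle r2 L S.
Proof.
move=> r12; have lpE x p : lpath r1 x p = lpath r2 x p.
  have [n] := ubnP (size p); elim: n x p => // n IH x [|y [|z p]] //= sz.
  by rewrite r12 IH // ltnW // -ltnS ltnW.
by apply: eq_has => x; apply: eq_existsb => p; rewrite lpE.
Qed.

Lemma ramsey_upper_bound r n m S : symmetric3 r -> 3 <= m -> m <= n -> uniq S ->
  2 * n + (m - 1) %/ 2 <= size S ->
  has_cycle r n S || has_cycle (colour r false) m S.
Proof.
have [l] := ubnP (n + m); elim: l r n m => // l IH r n m nml r3 m3 mn uS szS.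
(* Stated for an arbitrary [r'], since it is also applied with the colours exchanged. *)
have step r' : symmetric3 r' -> 3 < n -> has_cycle r' n.-1 S ->
    has_cycle r' n S || has_cycle (colour r' false) m S.
  move=> r3' n3 /cycle_of_has[x [p rc]].
  have [//|ncyc /=] := boolP (has_cycle r' n S).
  have nE : n.-1.+1 = n by lia.
  rewrite -nE in ncyc.
  have [m4|m4] := leqP m 4.
    have szS3 : 2 * n.-1 + 3 <= size S by lia.
    have [m_eq|m_ne3] := eqVneq m 3.
      by rewrite m_eq; apply: (triangle_step r3' _ rc uS szS3 ncyc); lia.
    have m_eq : m = 4 by lia.
    have [n_eq|n_ne4] := eqVneq n 4.
      rewrite m_eq; rewrite n_eq /= in rc ncyc *.
      by apply: (nine_vertices r3' rc uS _ ncyc); lia.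
    by rewrite m_eq; apply: (quadrangle_step r3' _ rc uS szS3 ncyc); lia.
  (* Here [k] is [2] for odd [m] and [3] for even [m]. The number of vertices fits because
     [2 * n.-1 + (j + 3)] equals [2 * n + (m - 1) %/ 2]. *)
  pose j := (m - 3) %/ 2; pose k := m - 1 - 2 * j.
  have -> : m = 2 * j + k.+1 by rewrite /k /j; lia.
  by apply: (long_cycle_step r3' _ _ _ rc uS _ ncyc); rewrite /k /j; lia.
have [nm|nm] := ltnP m n.
  have /orP[|->] : has_cycle r n.-1 S || has_cycle (colour r false) m S.
  - by apply: IH => //; lia.
  - by apply: step => //; lia.
  by rewrite orbT.
have {}nm : n = m by lia.
have [n3|n3] := leqP n 3.
  have [-> ->] : n = 3 /\ m = 3 by lia.
  by apply: seven_vertices => //; lia.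
(* For [n = m] the induction shortens the blue cycle, which then plays the part of the red one. *)
have /orP[->//|] : has_cycle r n S || has_cycle (colour r false) m.-1 S.
  by apply: IH => //; lia.
rewrite -nm => blue; have := step _ (colour_sym false r3) n3 blue; rewrite -nm.
rewrite orbC (@eq_has_cycle (colour _ false) r) // => x y z.
by rewrite /= negbK.
Qed.

End RamseyUpperBound.

(** * Copies of loose cycles and the extremal colouring *)

(** Only the last edge wraps around; its second and third vertices are [0] and [1]. *)
Lemma loose_edgeE n i (v : 'I_(2 * n)) : 1 < n -> i < n ->
  (v \in loose_edge n i) =
  [|| v == 2 * i + 1 :> nat, v == 2 * i + 2 :> nat, v == 2 * i + 3 :> nat |
      (i.+1 == n) && (v < 2)].
Proof.
move=> n1 lin; have ltv := ltn_ord v; rewrite inE (modn_small ltv).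
rewrite (@modn_small (2 * i + 1)); last by lia.
have [i_eq|i_ne] := eqVneq i.+1 n.
  have -> : 2 * i + 2 = 2 * n by lia.
  have -> : 2 * i + 3 = 1 + 2 * n by lia.
  by rewrite modnn modnDr modn_small; lia.
by rewrite !modn_small; lia.
Qed.

Lemma lpath_nth (T : finType) (r : T -> T -> T -> bool) d x p i :
  lpath r x p -> 2 * i + 1 < size p ->
  r (nth d (x :: p) (2 * i)) (nth d (x :: p) (2 * i + 1)) (nth d (x :: p) (2 * i + 2)).
Proof.
elim: i x p => [|i IH] x [|y [|z p]] pp szp; try by move: szp => /=; lia.
  by case/andP: pp.
case/andP: pp => _ pp; have := IH z p pp.
have -> : 2 * i.+1 = (2 * i).+2 by lia.
by rewrite !addSn; apply; move: szp => /=; lia.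
Qed.

Lemma cycle_copy N n (r : 'I_N -> 'I_N -> 'I_N -> bool) x S (E : {set {set 'I_N}}) :
  1 < n -> linked r n x x S ->
  (forall u v w, #|[set u; v; w]| = 3 -> r u v w -> [set u; v; w] \in E) ->
  contains_copy (loose_cycle n) (Hypergraph E).
Proof.
move=> n1 /linkedP[p [szp up lp _ pp]] rE.
have n2 : 0 < 2 * n by lia.
(* The shift is [-2] modulo [2 * n]: vertex [1] goes to the last entry of [p], which is [x], and
   vertex [2] to the first entry. Thus the edges of the cycle match those of the path. *)
pose g j := nth x p ((j + (2 * n - 2)) %% (2 * n)).
have gE j : 0 < j -> j < 2 * n + 2 -> g j = nth x (x :: p) j.-1.
  case: j => [//|[|j]] _ jn.
    rewrite /g; have -> : 1 + (2 * n - 2) = (size p).-1 by lia.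
    by rewrite modn_small ?nth_last ?lp //; lia.
  rewrite /g; have -> : j.+2 + (2 * n - 2) = j + 2 * n by lia.
  by rewrite modnDr modn_small //; lia.
have gmod j : g (j %% (2 * n)) = g j by rewrite /g modnDml.
have f_inj : injective (fun v : 'I_(2 * n) => g v).
  move=> u v; rewrite /g => /eqP; rewrite nth_uniq ?szp ?ltn_pmod // eqn_modDr.
  by rewrite !modn_small // => /eqP/val_inj.
exists (fun v : 'I_(2 * n) => g v); split=> // _ /imsetP[i _ ->].
pose v j : 'I_(2 * n) := Ordinal (ltn_pmod (2 * i + j) n2).
have card3 : #|(fun v : 'I_(2 * n) => g v) @: loose_edge n i| = 3.
  by rewrite card_imset //; apply: (loose_cycle_uniform n1); apply: imset_f.
have eE : loose_edge n i = [set v 1; v 2; v 3].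
  by apply/setP=> u; rewrite !inE -!val_eqE /= !(modn_small (ltn_ord u)) orbA.
have lin := ltn_ord i.
move: card3; rewrite eE !imsetU !imset_set1 /= !gmod !gE; try lia.
move=> card3; apply: rE => //.
rewrite !addnS !addn0 /=.
have := @lpath_nth _ r x x p i pp; rewrite !addnS !addn0; apply; lia.
Qed.

Lemma loose_edge_cover n (v : 'I_(2 * n)) : 1 < n ->
  exists2 e, e \in edges (loose_cycle n) & v \in e.
Proof.
move=> n1; have ltv := ltn_ord v.
(* The edge has the index [(v - 1) %/ 2]; adding [2 * n] first keeps the subtraction meaningful for
   [v = 0], which belongs to the last edge. *)
have lin : (v + 2 * n - 1) %/ 2 %% n < n by rewrite ltn_pmod //; lia.
exists (loose_edge n (Ordinal lin)); first exact: imset_f.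
rewrite loose_edgeE //=.
have [v0|v0] := posnP v.
  have -> : (v + 2 * n - 1) %/ 2 %% n = n.-1 by rewrite modn_small; lia.
  lia.
have -> : (v + 2 * n - 1) %/ 2 = (v - 1) %/ 2 + n by lia.
by rewrite modnDr modn_small; lia.
Qed.

(* Every vertex lies on at most two edges. *)
Lemma loose_edge_index n (i : 'I_n) (v : 'I_(2 * n)) : 1 < n ->
  v \in loose_edge n i ->
  i = (v + 2 * n - 1) %/ 2 %% n :> nat \/ i = (v + 2 * n - 3) %/ 2 %% n :> nat.
Proof.
move=> n1; have lin := ltn_ord i; have ltv := ltn_ord v.
rewrite loose_edgeE // => /or4P[/eqP|/eqP|/eqP|/andP[/eqP iE v2]] => [vE|vE|vE|].
- left; have -> : (v + 2 * n - 1) %/ 2 = i + n by lia.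
  by rewrite modnDr modn_small.
- left; have -> : (v + 2 * n - 1) %/ 2 = i + n by lia.
  by rewrite modnDr modn_small.
- right; have -> : (v + 2 * n - 3) %/ 2 = i + n by lia.
  by rewrite modnDr modn_small.
have [v0|v1] := posnP v.
  by left; rewrite modn_small; lia.
by right; rewrite modn_small; lia.
Qed.

(** * The lower bound *)

Section ExtremalColouring.

Variables (N a : nat).

Definition low_colour (e : {set 'I_N}) := if [forall v in e, v < a] then Red else Blue.

(** Every vertex of the cycle lies on an edge, so a red copy would inject [2 * n] vertices into the
    [a] low ones. *)
Lemma low_colour_red n : 1 < n -> a < 2 * n ->
  ~ contains_copy (loose_cycle n) (red_part low_colour).
Proof.
move=> n1 an [f [f_inj fE]].
have f_low (v : 'I_(2 * n)) : f v < a.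
  have [e eE ve] := loose_edge_cover v n1.
  have := fE e eE; rewrite inE /low_colour => /andP[_].
  by case: ifP => // /forall_inP/(_ (f v)) => lt _; apply: lt; apply: imset_f.
have := @leq_card _ _ (fun v => Ordinal (f_low v)).
rewrite !card_ord leqNgt an => /(_ _)/negP[] // u v [] /val_inj; exact: f_inj.
Qed.

(** Each of the [m] edges of a blue copy has a vertex in [B], the preimage of the high vertices, and
    each vertex of [B] accounts for at most two edges. *)
Lemma low_colour_blue m : 1 < m -> 2 * (N - a) < m ->
  ~ contains_copy (loose_cycle m) (blue_part low_colour).
Proof.
move=> m1 Nm [f [f_inj fE]].
pose B := [set v : 'I_(2 * m) | a <= f v].
have cardB : #|B| <= N - a.
  have Bsub v : v \in B -> f v - a < N - a.
    by rewrite inE => av; have := ltn_ord (f v); lia.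
  case: (posnP (N - a)) => [Na|Na].
    rewrite Na leqn0 cards_eq0; apply/eqP/setP => v; rewrite in_set0.
    by apply/negbTE/negP => /Bsub; rewrite Na.
  (* On [B] the difference is below [N - a], so the default value never occurs there. *)
  pose h (v : 'I_(2 * m)) : 'I_(N - a) := insubd (Ordinal Na) (f v - a).
  rewrite -[leqRHS]card_ord -(@card_in_imset _ _ h); first exact: max_card.
  move=> u v uB vB /(congr1 val); rewrite !val_insubd !Bsub //.
  move: uB vB; rewrite !inE => ua va uv; apply/f_inj/val_inj => /=.
  by rewrite -(subnK ua) uv subnK.
have m0 : 0 < m by lia.
(* The two candidates from [loose_edge_index] for an edge through [v]. *)
pose h1 (v : 'I_(2 * m)) : 'I_m := Ordinal (ltn_pmod ((v + 2 * m - 1) %/ 2) m0).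
pose h2 (v : 'I_(2 * m)) : 'I_m := Ordinal (ltn_pmod ((v + 2 * m - 3) %/ 2) m0).
have : [set: 'I_m] \subset h1 @: B :|: h2 @: B.
  apply/subsetP => i _.
  have eE : loose_edge m i \in edges (loose_cycle m) by apply: imset_f.
  have := fE _ eE; rewrite inE /low_colour => /andP[_]; case: ifPn => // /forall_inPn[w].
  case/imsetP=> v vi ->; rewrite -leqNgt => av _; rewrite inE.
  have vB : v \in B by rewrite inE.
  have [i1|i2] := loose_edge_index m1 vi.
    by rewrite (_ : i = h1 v) ?imset_f //; apply: val_inj.
  by rewrite (_ : i = h2 v) ?imset_f ?orbT //; apply: val_inj.
move/subset_leq_card; rewrite cardsT card_ord leqNgt => /negP; apply.
apply: leq_ltn_trans (leq_of_leqif (leq_card_setU _ _)) _.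
apply: leq_ltn_trans (leq_add (leq_imset_card _ _) (leq_imset_card _ _)) _.
by rewrite addnn -mul2n (leq_ltn_trans _ Nm) // leq_mul2l cardB.
Qed.

End ExtremalColouring.

Theorem theorem2p8 (n m : nat) (hm : 3 <= m) (hmn : m <= n) :
  is_ramsey_number (loose_cycle n) (loose_cycle m) (2 * n + (m - 1) %/ 2).
Proof.
split=> [c|N arr].
  pose N := 2 * n + (m - 1) %/ 2.
  pose r (u v w : 'I_N) := is_red (c [set u; v; w]).
  have r_sym : symmetric3 r.
    split=> u v w; congr (is_red (c _)); last exact: setUAC.
    by rewrite (setUC [set u]).
  have szN : 2 * n + (m - 1) %/ 2 <= size (enum 'I_N) by rewrite size_enum_ord.
  have /orP[/hasP[x _ lk]|/hasP[x _ lk]] :=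
    ramsey_upper_bound r_sym hm hmn (enum_uniq 'I_N) szN; [left | right].
    by apply: cycle_copy lk _ => [|u v w u3 ruvw]; [lia | rewrite !inE u3 eqxx].
  by apply: cycle_copy lk _ => [|u v w u3 ruvw]; [lia | rewrite !inE u3 eqxx].
rewrite leqNgt; apply/negP => ltN.
(* With [2 * n - 1] low vertices, at most [(m - 1) %/ 2] high ones remain, and twice that number is
   less than [m]. *)
have [] := arr (@low_colour N (2 * n - 1)).
  by apply: low_colour_red; lia.
by apply: low_colour_blue; lia.
Qed.
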